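(* Let $T\subset\mathbb{R}^2$ be an open scalene triangle with sides $\Gamma_1,\Gamma_2,\Gamma_3$, and let $V_1,V_2,V_1^D,V_2^D\subset H^1(T)^7$ be the spaces defined in the context. There is no invertible operator $\Phi\colon L_2(T)^7\to L_2(T)^7$ of the form $(\Phi u)_k=\sum_{l=1}^7p_{kl}\,u_l$, where $P=(p_{kl})$ is an invertible real $7\times7$ matrix (so that $(\Phi^*u)_l=\sum_{k=1}^7p_{kl}\,u_k$), which simultaneously satisfies $$\Phi(V_1)\subset V_2\quad\text{and}\quad\Phi^*(V_2)\subset V_1$$ and $$\Phi(V_1^D)\subset V_2^D\quad\text{and}\quad\Phi^*(V_2^D)\subset V_1^D.$$
   Context: All equalities on the sides $\Gamma_j$ are in the sense of traces of $H^1(T)$ functions. $V_1$ is the set of $(u_1,\dots,u_7)\in H^1(T)^7$ such that $u_1=u_2$ and $u_4=u_7$ on $\Gamma_1$; $u_1=u_3$ and $u_2=u_5$ on $\Gamma_2$; $u_1=u_4$ and $u_3=u_6$ on $\Gamma_3$. $V_2$ is the set of $(u_1,\dots,u_7)\in H^1(T)^7$ such that $u_1=u_2$ and $u_3=u_6$ on $\Gamma_1$; $u_1=u_3$ and $u_4=u_7$ on $\Gamma_2$; $u_1=u_4$ and $u_2=u_5$ on $\Gamma_3$. $V_1^D$ is the set of $u\in V_1$ such that in addition $u_3=u_5=u_6=0$ on $\Gamma_1$; $u_4=u_6=u_7=0$ on $\Gamma_2$; $u_2=u_5=u_7=0$ on $\Gamma_3$. $V_2^D$ is the set of $u\in V_2$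 such that in addition $u_4=u_5=u_7=0$ on $\Gamma_1$; $u_2=u_5=u_6=0$ on $\Gamma_2$; $u_3=u_6=u_7=0$ on $\Gamma_3$. *)

(* Defs.v *)
From HB Require Import structures.
From mathcomp Require Import all_boot all_order all_algebra.
From mathcomp Require Import all_classical all_reals all_analysis.

Set Implicit Arguments.
Unset Strict Implicit.
Unset Printing Implicit Defensive.

Import Order.TTheory GRing.Theory Num.Theory.
Import numFieldNormedType.Exports.

Local Open Scope classical_set_scope.
Local Open Scope ring_scope.

(* The plane is R * R.  The norm that MathComp-Analysis puts on it is the sup
   norm (same topology), so lengths are computed with the Euclidean distance
   [edist]. *)

Section Sobolev.
Variable R : realType.
Implicit Types (D T : set (R * R)) (p q a b c : R * R) (u v f g : R * R -> R).

Definition edist p q : R := Num.sqrt ((p.1 - q.1) ^+ 2 + (p.2 - q.2) ^+ 2).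

(* The hypothesis that makes [a], [b], [c] the vertices of a (non-degenerate)
   scalene triangle. *)
Definition scalene a b c : Prop :=
  [/\ (b.1 - a.1) * (c.2 - a.2) - (b.2 - a.2) * (c.1 - a.1) != 0,
      edist b c != edist c a, edist c a != edist a b & edist a b != edist b c].

Definition open_triangle a b c : set (R * R) :=
  [set x | exists r s t : R, [/\ 0 < r, 0 < s, 0 < t, r + s + t = 1 &
                                x = r *: a + s *: b + t *: c]].

Local Notation mu2 := (@lebesgue_measure R \x @lebesgue_measure R)%E.

(* Elements of L_2(D) are represented by functions on R^2, of which only the
   values on D (up to a null set) matter: [f \_ D] is the extension by 0. *)
Definition L2 D : set (R * R -> R) := [set f | f \_ D \in Lfun mu2 2%:E].

Definition L2norm D f : \bar R := 'N[mu2]_2%:E[EFin \o (f \_ D)]%E.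

Definition e1 : R * R := (1, 0).
Definition e2 : R * R := (0, 1).

Fixpoint Ck (n : nat) f : Prop :=
  continuous f /\
  if n is m.+1 then
    [/\ forall x, derivable f x e1, forall x, derivable f x e2,
        Ck m ('D_e1 f) & Ck m ('D_e2 f)]
  else True.

Definition smooth f : Prop := forall n, Ck n f.

Definition test_function D f : Prop :=
  [/\ smooth f, compact (closure (f @^-1` [set~ 0])) &
      closure (f @^-1` [set~ 0]) `<=` D].

Definition weak_derivative D (e : R * R) u g : Prop :=
  forall phi, test_function D phi ->
    \int[mu2]_(x in D) (u x * 'D_e phi x) = - \int[mu2]_(x in D) (g x * phi x).

(* [u] is in H^1(D) and its weak gradient is (g1, g2). *)
Definition H1_grad D u g1 g2 : Prop :=
  [/\ L2 D u, L2 D g1, L2 D g2,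
      weak_derivative D e1 u g1 & weak_derivative D e2 u g2].

Definition H1 D : set (R * R -> R) := [set u | exists g1 g2, H1_grad D u g1 g2].

Definition H1_cvg D (phi : nat -> R * R -> R) u : Prop :=
  exists g1 g2, [/\ H1_grad D u g1 g2,
    L2norm D (phi n \- u) @[n --> \oo] --> 0%E,
    L2norm D ('D_e1 (phi n) \- g1) @[n --> \oo] --> 0%E &
    L2norm D ('D_e2 (phi n) \- g2) @[n --> \oo] --> 0%E].

(* The segment [p, q], parametrized by arc length on [0, edist p q]. *)
Definition seg p q (t : R) : R * R := p + (t / edist p q) *: (q - p).

Definition on_seg p q f : R -> R := (f \o seg p q) \_ `[0, edist p q].

Definition L2seg p q : set (R * R -> R) :=
  [set g | on_seg p q g \in Lfun lebesgue_measure 2%:E].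

Definition L2seg_norm p q g : \bar R :=
  'N[lebesgue_measure]_2%:E[EFin \o on_seg p q g]%E.

(* [g] represents the trace of [u : H^1(D)] on the side [p, q]: the trace is the
   H^1(D)-to-L_2(side) continuous extension of the restriction of functions
   that are smooth up to the boundary. *)
Definition is_trace D p q u g : Prop :=
  L2seg p q g /\
  exists phi : nat -> R * R -> R,
    [/\ forall n, smooth (phi n), H1_cvg D phi u &
        L2seg_norm p q (phi n \- g) @[n --> \oo] --> 0%E].

Definition eq_on_side D p q u v : Prop :=
  exists g, is_trace D p q u g /\ is_trace D p q v g.

Definition zero_on_side D p q u : Prop := is_trace D p q u (cst 0).

End Sobolev.

Section Spaces.
Variable R : realType.
Variables a b c : R * R.
Implicit Types (u : 'I_7 -> R * R -> R).

Local Notation T := (open_triangle a b c).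

(* The components are numbered from 1 to 7. *)
Definition cpt u (k : nat) : R * R -> R := u (inord k.-1).
Local Notation "u `[ k ]" := (cpt u k) (at level 2, format "u `[ k ]").

(* The sides Gamma_1, Gamma_2, Gamma_3 are those opposite to a, b, c. *)
Local Notation eq1 := (eq_on_side T b c).
Local Notation eq2 := (eq_on_side T c a).
Local Notation eq3 := (eq_on_side T a b).
Local Notation zero1 := (zero_on_side T b c).
Local Notation zero2 := (zero_on_side T c a).
Local Notation zero3 := (zero_on_side T a b).

Definition L2_7 : set ('I_7 -> R * R -> R) := [set u | forall k, L2 T (u k)].

Definition H1_7 : set ('I_7 -> R * R -> R) := [set u | forall k, H1 T (u k)].

Definition V1 : set ('I_7 -> R * R -> R) := [set u | H1_7 u /\
  [/\ eq1 u`[1] u`[2] /\ eq1 u`[4] u`[7],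
      eq2 u`[1] u`[3] /\ eq2 u`[2] u`[5] &
      eq3 u`[1] u`[4] /\ eq3 u`[3] u`[6]]].

Definition V2 : set ('I_7 -> R * R -> R) := [set u | H1_7 u /\
  [/\ eq1 u`[1] u`[2] /\ eq1 u`[3] u`[6],
      eq2 u`[1] u`[3] /\ eq2 u`[4] u`[7] &
      eq3 u`[1] u`[4] /\ eq3 u`[2] u`[5]]].

Definition V1D : set ('I_7 -> R * R -> R) := [set u | V1 u /\
  [/\ [/\ zero1 u`[3], zero1 u`[5] & zero1 u`[6]],
      [/\ zero2 u`[4], zero2 u`[6] & zero2 u`[7]] &
      [/\ zero3 u`[2], zero3 u`[5] & zero3 u`[7]]]].

Definition V2D : set ('I_7 -> R * R -> R) := [set u | V2 u /\
  [/\ [/\ zero1 u`[4], zero1 u`[5] & zero1 u`[7]],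
      [/\ zero2 u`[2], zero2 u`[5] & zero2 u`[6]] &
      [/\ zero3 u`[3], zero3 u`[6] & zero3 u`[7]]]].

(* The operator u |-> P u; its L_2-adjoint is [mxop P^T]. *)
Definition mxop (P : 'M[R]_7) u : 'I_7 -> R * R -> R :=
  fun k x => \sum_(l < 7) P k l * u l x.

End Spaces.

(* Main.v *)
(** Let [h] be the product of the two barycentric coordinates that do not
    vanish identically on a side.  It is zero on the other two sides, so the
    field [v h] with [v] in R^7 belongs to one of the four spaces as soon as
    [v] satisfies the linear conditions of that single side.  Hence [P] and
    [P^T] map the corresponding subspaces of R^7 into each other.  On side 1,
    for [l = 3, 5, 6], [P e_l] has equal components 1 and 2, while
    [P^T (e_1 + e_2)] has a vanishing component [l]: thus [P_1l = 0].  The other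
    two sides give [P_1l = 0] for all [l > 1].  Then [P^T e_2] satisfies the
    conditions of side 2, whence [P_21 = P_22 = 0], and [P (e_1 + e_2)] those
    of side 1, whence [P_11 = 0]: the first row of [P] vanishes.

    Reading the linear conditions off the traces of [v h] requires that a trace
    be determined by the function.  Green's formula is applied to smooth
    approximations multiplied by weights [w_k] that all agree on one side,
    vanish on the other two and tend to 0 in the interior.  The part of the
    area integral that involves the weak gradient tends to 0 as [k] grows, so
    the side integral of the trace depends on the function only. *)

Require Import Defs.
From mathcomp Require Import all_boot all_order all_algebra.
From mathcomp Require Import all_classical all_reals all_analysis.
From mathcomp Require Import measurable_realfun ring lra.
Set Implicit Arguments.
Unset Strict Implicit.
Unset Printing Implicit Defensive.
Import Order.TTheory GRing.Theory Num.Theory.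
Import numFieldNormedType.Exports.
Local Open Scope classical_set_scope.
Local Open Scope ring_scope.

(** * Square-integrable functions *)

Section L2pairing.
Context d (T : measurableType d) (R : realType) (mu : {measure set T -> \bar R}).

Lemma bounded_Lfun2 (D : set T) (f : T -> R) (K : R) : measurable D ->
  (mu D < +oo)%E -> measurable_fun D f -> (forall x, D x -> `|f x| <= K) ->
  f \_ D \in Lfun mu 2%:E.
Proof.
move=> mD Dfin mf fK; rewrite inE; apply/andP; split; rewrite inE/=.
  exact/(measurable_restrictT _ _).1.
rewrite /finite_norm unlock poweR_lty//.
have -> : (\int[mu]_x (`|(EFin \o f \_ D) x| `^ 2) = \int[mu]_(x in D) (`|f x| ^+ 2)%:E)%E.
  rewrite [RHS]integral_mkcond; apply: eq_integral => x _ /=.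
  rewrite !patchE; case: ifP => _ /=; first by rewrite -powR_mulrn.
  by rewrite normr0 powR0// pnatr_eq0.
apply: integrable_lty => //; apply: measurable_bounded_integrable => //.
  by apply: measurable_funX; exact: measurableT_comp.
exists (K ^+ 2); split; first exact: num_real.
move=> y Ky x Dx /=; rewrite normrX normr_id (le_trans _ (ltW Ky))//.
by rewrite lerXn2r// ?nnegrE ?fK// (le_trans _ (fK _ Dx)).
Qed.

Lemma Lfun2_integrable (f g : T -> R) : f \in Lfun mu 2%:E -> g \in Lfun mu 2%:E ->
  mu.-integrable setT (EFin \o (f \* g)).
Proof. by move=> f2 g2; apply/Lfun1_integrable; exact: Lfun2_mul_Lfun1. Qed.

Lemma Rintegral_hoelder (f g : T -> R) : f \in Lfun mu 2%:E -> g \in Lfun mu 2%:E ->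
  (`| \int[mu]_x (f x * g x) |%:E <= 'N[mu]_2%:E[EFin \o f] * 'N[mu]_2%:E[EFin \o g])%E.
Proof.
move=> f2 g2.
have mf := sub_Lfun_mfun f2; have mg := sub_Lfun_mfun g2.
rewrite inE/= in mf; rewrite inE/= in mg.
have fg := Lfun2_integrable f2 g2.
rewrite EFin_normr_Rintegral//.
apply: le_trans (le_abse_integral _ _ _) _ => //.
  by case/integrableP: fg.
have := @hoelder _ _ _ mu f g 2 2 mf mg; rewrite Lnorm1; apply => //.
by lra.
Qed.

(** By Hölder, the difference of the integrals is at most the product of the norms of [fn n - f] and
    [g]. This carries Green's formula from smooth approximations to their limit, in the area and on
    the side alike. *)
Lemma L2_cvg_pairing (fn : nat -> T -> R) (f g : T -> R) :
  (forall n, fn n \in Lfun mu 2%:E) -> f \in Lfun mu 2%:E -> g \in Lfun mu 2%:E ->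
  'N[mu]_2%:E[EFin \o (fn n \- f)%R]%E @[n --> \oo] --> 0%E ->
  (fun n => \int[mu]_x (fn n x * g x)) @ \oo --> \int[mu]_x (f x * g x).
Proof.
move=> fn2 f2 g2 fnf.
have fnf2 n : fn n \- f \in Lfun mu 2%:E.
  have -> : fn n \- f = fn n - f by [].
  by apply: rpredB; rewrite ?lee1n.
have gfin : 'N[mu]_2%:E[EFin \o g]%E \is a fin_num.
  by rewrite ge0_fin_numE ?Lnorm_ge0//; have := sub_Lfun_finLfun g2; rewrite inE.
have nfin n : 'N[mu]_2%:E[EFin \o (fn n \- f)%R]%E \is a fin_num.
  by rewrite ge0_fin_numE ?Lnorm_ge0//; have := sub_Lfun_finLfun (fnf2 n); rewrite inE.
apply/subr_cvg0.
have -> : (fun n => \int[mu]_x (fn n x * g x) - \int[mu]_x (f x * g x)) =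
          (fun n => \int[mu]_x ((fn n \- f) x * g x)).
  apply/funext => n; rewrite -RintegralB//; first last.
  - exact: Lfun2_integrable.
  - exact: Lfun2_integrable.
  by apply: eq_Rintegral => x _ /=; rewrite mulrBl.
apply: norm_cvg0.
pose B n := fine 'N[mu]_2%:E[EFin \o (fn n \- f)%R]%E * fine 'N[mu]_2%:E[EFin \o g]%E.
apply: (@squeeze_cvgr _ _ _ _ (cst 0) B); rewrite /B.
- apply: nearW => n; rewrite normr_ge0/= -lee_fin EFinM !fineK//.
  exact: (Rintegral_hoelder (fnf2 n) g2).
- exact: cvg_cst.
- have /fine_cvgP[_ fnf0] := fnf.
  rewrite -[X in _ --> X](mul0r (fine 'N[mu]_2%:E[EFin \o g]%E)).
  by apply: cvgM => //; exact: cvg_cst.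
Qed.

End L2pairing.

(** * Measurability and integrability in the plane *)

Section Plane.
Variable R : realType.
Implicit Types (D : set (R * R)) (f g : R * R -> R).
Local Notation mu2 := (@lebesgue_measure R \x @lebesgue_measure R)%E.

Definition square (M : R) : set (R * R) := `[- M, M] `*` `[- M, M].

Lemma measurable_square M : measurable (square M).
Proof. by apply: measurableX. Qed.

Lemma square_finite M : (mu2 (square M) < +oo)%E.
Proof.
rewrite product_measure1E//= lebesgue_measure_itv/=.
by case: ifP => _; rewrite ?mul0e// -EFinM ltry.
Qed.

(** The plane carries the product sigma-algebra, so an open set is written as a countable union of
    boxes with rational centres and radii 1/(n+1). All boxes are indexed; those not inside [O]
    contribute the empty set. *)
Lemma open_measurable_plane (O : set (R * R)) : open O -> measurable O.
Proof.
move=> oO.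
pose B (i : rat * rat * nat) : set (R * R) :=
  ball (ratr i.1.1 : R) (i.2.+1%:R^-1) `*` ball (ratr i.1.2 : R) (i.2.+1%:R^-1).
have mB i : measurable (B i).
  by apply: measurableX; rewrite ball_itv.
have -> : O = \bigcup_i [set y | B i `<=` O /\ B i y].
  apply/seteqP; split; last first.
    by move=> x [i _] [BO /BO].
  move=> x Ox.
  have [e /= e0 xeO] : exists2 e : R, 0 < e & ball x e `<=` O.
    by apply/nbhs_ballP; move: oO; rewrite openE => /(_ x Ox).
  (* A box of radius d whose centre is within d of x stays within 2 d < e of x. *)
  have [n ne] : exists n : nat, n.+1%:R^-1 < e / 2 :> R.
    have e20 : 0 < e / 2 by rewrite divr_gt0.
    by have [n _ /(_ _ (leqnn _))] := near_infty_natSinv_lt (PosNum e20); exists n.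
  pose d : R := n.+1%:R^-1.
  have d0 : 0 < d by rewrite invr_gt0.
  have rat_near (y : R) : exists q : rat, `|ratr q - y| < d.
    have /rat_in_itvoo [q'] : y - d < y + d by lra.
    by rewrite in_itv/= => /andP[? ?]; exists q'; rewrite ltr_distl; apply/andP.
  have [q1 q1x] := rat_near x.1; have [q2 q2x] := rat_near x.2.
  exists (q1, q2, n) => //; split; last by split; rewrite /= /ball/=.
  move=> y [/= y1 y2]; apply: xeO; split; rewrite /= /ball/=.
    rewrite (le_lt_trans (ler_distD (ratr q1) _ _))// [e]splitr ltrD//.
      by rewrite distrC (lt_trans q1x).
    exact: lt_trans y1 ne.
  rewrite (le_lt_trans (ler_distD (ratr q2) _ _))// [e]splitr ltrD//.
    by rewrite distrC (lt_trans q2x).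
  exact: lt_trans y2 ne.
apply: countable_bigcupT_measurable => // i.
have [BO|BO] := pselect (B i `<=` O).
  rewrite (_ : [set _ | _] = B i)//.
  by apply/seteqP; split=> y // [].
rewrite (_ : [set _ | _] = set0)//.
by apply/seteqP; split=> y // [].
Qed.

Lemma continuous_measurable_plane f : continuous f -> measurable_fun setT f.
Proof.
move=> cf; apply: (measurability _ (RGenOInfty.measurableE R)).
move=> _ [_ [a ->] <-]; rewrite setTI; apply: open_measurable_plane.
by apply: open_comp => // x _; exact: cf.
Qed.

Lemma continuous_bounded_square f M : continuous f ->
  exists2 K, 0 <= K & forall x, square M x -> `|f x| <= K.
Proof.
move=> cf.
have : compact (f @` square M).
  apply: continuous_compact; first exact: continuous_subspaceT.
  by apply: compact_setX; exact: segment_compact.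
move=> /compact_bounded /ex_strict_bound_gt0 [K K0 fK].
exists K; first exact: ltW.
by move=> x Mx; apply/ltW/fK; exists x.
Qed.

Lemma bounded_integrable_plane D f (M K : R) : measurable D -> D `<=` square M ->
  measurable_fun D f -> (forall x, D x -> `|f x| <= K) ->
  mu2.-integrable D (EFin \o f).
Proof.
move=> mD DM mf fK.
apply: (@measurable_bounded_integrable _ _ _ mu2 f D) => //.
  apply: le_lt_trans (square_finite M); apply: le_measure => //; rewrite inE//.
  exact: measurable_square.
by exists K; split; [exact: num_real|move=> y Ky x Dx; exact: le_trans (fK _ Dx) (ltW Ky)].
Qed.

Lemma bounded_support_integrable f (M K : R) : measurable_fun setT f ->
  (forall x, ~ square M x -> f x = 0) -> (forall x, square M x -> `|f x| <= K) ->
  mu2.-integrable setT (EFin \o f).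
Proof.
move=> mf f0 fK.
rewrite (_ : f = f \_ (square M)); last first.
  apply/funext => x; rewrite patchE; case: (boolP (x \in square M)) => //.
  by rewrite notin_setE => /f0 ->.
rewrite -restrict_EFin; apply/integrable_restrict => //; first exact: measurable_square.
rewrite setTI; apply: (@bounded_integrable_plane _ _ M K) => //; first exact: measurable_square.
exact: measurable_funTS.
Qed.

Lemma bounded_L2_plane D f (M K : R) : measurable D -> D `<=` square M ->
  measurable_fun D f -> (forall x, D x -> `|f x| <= K) -> L2 D f.
Proof.
move=> mD DM mf fK; apply: (@bounded_Lfun2 _ _ _ mu2 D f K) => //.
apply: le_lt_trans (square_finite M); apply: le_measure => //; rewrite inE//.
exact: measurable_square.
Qed.

End Plane.

(** * Green's formula on a half-plane *)

Section Deriv.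
Variable R : realType.

Lemma in_setb (T : Type) (b : T -> bool) (x : T) : (x \in [set y | b y]) = b x.
Proof. by apply/idP/idP; rewrite inE. Qed.

Lemma derive_near0 (V : normedModType R) (f : V -> R) (x v : V) :
  (\forall y \near x, f y = 0) -> 'D_v f x = 0.
Proof.
move=> f0; apply: cvg_lim => //.
apply: (@cvg_near_cst _ _ 0 _ _ _).
have hx : h *: v + x @[h --> (0 : R)] --> x.
  rewrite -[X in _ --> X]add0r -[X in _ --> X + _](scale0r v).
  apply: cvgD; last exact: cvg_cst.
  by apply: cvgZ; [exact: cvg_id|exact: cvg_cst].
have hf : \forall h \near (0 : R), f (h *: v + x) = 0 by exact: (hx _ f0).
apply: filterS (nbhs_dnbhs hf) => h /= fh; rewrite /shift/=.
by rewrite fh (nbhs_singleton f0) subr0 scaler0.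
Qed.

(** Regularity along the single direction [v]: enough for the fundamental theorem of calculus on
    lines parallel to [v], and stable under products and composition. *)
Definition C1 (V : normedModType R) (v : V) (f : V -> R) :=
  [/\ continuous f, forall x, derivable f x v & continuous ('D_v f)].

Lemma C1M (V : normedModType R) (v : V) (f g : V -> R) : C1 v f -> C1 v g ->
  C1 v (fun x => f x * g x) /\
  (forall x, 'D_v (fun y => f y * g y) x = f x * 'D_v g x + g x * 'D_v f x).
Proof.
move=> [cf df cDf] [cg dg cDg].
have DE : (forall x, 'D_v (fun y => f y * g y) x = f x * 'D_v g x + g x * 'D_v f x).
  by move=> x; exact: (deriveM (df x) (dg x)).
split; last exact: DE.
split.
- by move=> x; apply: cvgM; [exact: cf|exact: cg].
- by move=> x; exact: (derivableM (df x) (dg x)).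
- rewrite (_ : 'D_v _ = fun x => f x * 'D_v g x + g x * 'D_v f x); last exact/funext.
  by move=> x; apply: cvgD; apply: cvgM; [exact: cf|exact: cDg|exact: cg|exact: cDf].
Qed.

Local Notation mu := (@lebesgue_measure R).

Lemma integral_derive (f : R -> R) (a b : R) : a < b -> C1 (1 : R) f ->
  (\int[mu]_(x in `[a, b]) ('D_(1 : R) f x)%:E = (f b - f a)%:E)%E.
Proof.
move=> ab [cf df cDf]; rewrite (@continuous_FTC2 _ _ f)//.
- by apply: continuous_subspaceT.
- split; first by move=> x _; exact: df.
  + by apply: cvg_at_right_filter; exact: cf.
  + by apply: cvg_at_left_filter; exact: cf.
- by move=> x _; rewrite derive1E.
Qed.

(** The half-line ends at c = -D/A and goes right or left according to the sign of [A]. The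
    fundamental theorem, applied up to a point beyond the support, leaves the value at c with that
    sign. *)
Lemma integral_derive_halfline (f : R -> R) (M A D : R) : C1 (1 : R) f ->
  (forall x, M < `|x| -> f x = 0) -> A != 0 ->
  (\int[mu]_(s in [set s | (0 < A * s + D)%R]) ('D_(1 : R) f s)%:E =
   (- Num.sg A * f (- D / A))%:E)%E.
Proof.
move=> C1f f0 A0.
have [cf df cDf] := C1f.
pose c := - D / A.
have AE s : A * s + D = A * (s - c) by rewrite /c; field.
(* [N] exceeds both the support bound and |c|: [f] vanishes at N and -N, and c lies strictly between
   them. *)
pose N := Num.max `|M| `|c| + 1.
have NM x : N <= `|x| -> M < `|x|.
  move=> Nx; apply: le_lt_trans (ler_norm _) _; apply: lt_le_trans Nx.
  by rewrite /N ltr_pwDr// le_max lexx.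
have Nc : `|c| < N by rewrite /N ltr_pwDr// le_max lexx orbT.
have Df0 x : N <= `|x| -> 'D_(1 : R) f x = 0.
  move=> /NM Mx; apply: derive_near0.
  have : \forall y \near x, M < `|y|.
    exact: (cvgr_gt _ (@norm_continuous _ R x) _ Mx).
  by apply: filterS => y; exact: f0.
have mD : measurable_fun setT ('D_(1 : R) f) by exact: continuous_measurable_fun.
rewrite integral_mkcond.
have [A0'|Agt|Alt] := sgrP A.
- by rewrite A0' eqxx in A0.
- have -> : - 1 * f (- D / A) = f N - f (- D / A).
    by rewrite (f0 N) ?sub0r ?mulN1r//; apply: NM; exact: ler_norm.
  rewrite -integral_derive//; last by rewrite (le_lt_trans (ler_norm _) Nc).
  (* The half-line is open at c, the interval of the fundamental theorem is closed; the endpoint has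
     measure zero. *)
  rewrite -integral_itv_obnd_cbnd; last by apply/measurable_EFinP; exact: measurable_funS mD.
  rewrite [RHS]integral_mkcond; apply: eq_integral => x _; rewrite !patchE.
  rewrite (in_setb (fun s => 0 < A * s + D)) mem_setE AE pmulr_rgt0// subr_gt0 in_itv/=.
  case: ltP => //= cx; case: leP => // /ltW Nx.
  by rewrite Df0// (le_trans Nx)// ler_norm.
- have -> : - (- 1) * f (- D / A) = f (- D / A) - f (- N).
    by rewrite (f0 (- N)) ?subr0 ?opprK ?mul1r//; apply: NM; rewrite normrN ler_norm.
  rewrite -integral_derive//; last by rewrite ltrNl (le_lt_trans (ler_norm _))// normrN.
  rewrite -integral_itv_bndo_bndc; last by apply/measurable_EFinP; exact: measurable_funS mD.
  rewrite [RHS]integral_mkcond; apply: eq_integral => x _; rewrite !patchE.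
  rewrite (in_setb (fun s => 0 < A * s + D)) mem_setE AE nmulr_rgt0// subr_lt0 in_itv/= andbC.
  case: ltP => //= cx; case: leP => // /ltW Nx.
  by rewrite Df0// -normrN (le_trans _ (ler_norm _))// lerNr.
Qed.

Lemma integral_derive_line (f : R -> R) (M : R) : C1 (1 : R) f ->
  (forall x, M < `|x| -> f x = 0) ->
  (\int[mu]_s ('D_(1 : R) f s)%:E = 0)%E.
Proof.
move=> C1f f0.
have [cf df cDf] := C1f.
pose N := `|M| + 1.
have NM x : N <= `|x| -> M < `|x|.
  by move=> Nx; apply: le_lt_trans (ler_norm _) _; apply: lt_le_trans Nx; rewrite /N ltrDl.
have N0 : 0 < N by rewrite /N ltr_wpDl.
have Df0 x : N <= `|x| -> 'D_(1 : R) f x = 0.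
  move=> /NM Mx; apply: derive_near0.
  have : \forall y \near x, M < `|y|.
    exact: (cvgr_gt _ (@norm_continuous _ R x) _ Mx).
  by apply: filterS => y; exact: f0.
transitivity (f N - f (- N))%:E; last first.
  by rewrite !f0 ?subrr//; apply: NM; rewrite ?normrN ler_norm.
rewrite -integral_derive//; last by lra.
rewrite [RHS]integral_mkcond; apply: eq_integral => x _; rewrite !patchE.
rewrite !mem_setE/= in_itv/= -ler_norml.
by case: leP => // /ltW Nx; rewrite Df0.
Qed.

(* [pt s t] is the point with coordinate [s] along [e] and [t] along the other
   axis. *)
Definition is_axis (pt : R -> R -> R * R) (e : R * R) :=
  (e = e1 R /\ pt = fun s t => (s, t)) \/ (e = e2 R /\ pt = fun s t => (t, s)).

Lemma is_axis_shift pt e h s t : is_axis pt e -> pt (h + s) t = h *: e + pt s t.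
Proof.
case=> -[-> ->]; rewrite /e1 /e2; congr pair => /=;
  by rewrite -?[h *: _]/(h * _) ?mulr1 ?mulr0 ?add0r.
Qed.

Lemma is_axis_continuous pt e t : is_axis pt e -> continuous (pt ^~ t).
Proof.
case=> -[_ ->] s /=.
  by apply: (@cvg_pair _ _ _ _ (nbhs s) (nbhs t)); [exact: cvg_id|exact: cvg_cst].
by apply: (@cvg_pair _ _ _ _ (nbhs t) (nbhs s)); [exact: cvg_cst|exact: cvg_id].
Qed.

(** The slice and [F] have literally the same difference quotients, so derivability and derivatives
    transfer without a chain rule. *)
Lemma C1_slice pt e (F : R * R -> R) (t : R) : is_axis pt e -> C1 e F ->
  C1 (1 : R) (fun s => F (pt s t)) /\
  forall s, 'D_(1 : R) (fun s => F (pt s t)) s = 'D_e F (pt s t).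
Proof.
move=> ax [cF dF cDF].
have E s : (fun h : R => h^-1 *: (((fun s => F (pt s t)) \o shift s) (h *: 1) - F (pt s t))) =
         (fun h => h^-1 *: ((F \o shift (pt s t)) (h *: e) - F (pt s t))).
  by apply/funext => h /=; rewrite (is_axis_shift _ _ _ ax) [h *: 1]mulr1.
have DE s : 'D_(1 : R) (fun s => F (pt s t)) s = 'D_e F (pt s t).
  by rewrite /derive E.
have cpt := @is_axis_continuous pt e t ax.
split; last exact: DE.
split.
- by move=> s; apply: (cvg_comp (pt ^~ t) F (cpt s)); exact: cF.
- by move=> s; rewrite /derivable E; exact: dF.
- rewrite (_ : 'D_(1 : R) _ = fun s => 'D_e F (pt s t)); last exact/funext.
  by move=> s; apply: (cvg_comp (pt ^~ t) ('D_e F) (cpt s)); exact: cDF.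
Qed.

Local Notation mu2 := (mu \x mu)%E.

(** The order of integration follows the axis, so that the inner integral always runs along [e]. *)
Lemma fubini_axis pt e (f : R * R -> R) : is_axis pt e ->
  mu2.-integrable setT (EFin \o f) ->
  (\int[mu2]_x (f x)%:E = \int[mu]_t \int[mu]_s (f (pt s t))%:E)%E.
Proof.
move=> [[_ ->]|[_ ->]] intf.
- by rewrite -(integral21_prod_meas1 intf).
- by rewrite -(integral12_prod_meas1 intf).
Qed.

Lemma derive_support_square (F : R * R -> R) M e :
  (forall x, ~ square M x -> F x = 0) -> forall x, ~ square M x -> 'D_e F x = 0.
Proof.
move=> F0 x Mx; apply: derive_near0.
have : \forall y \near x, (~` square M) y.
  apply: open_nbhs_nbhs; split => //; rewrite openC.
  apply: compact_closed; first exact: norm_hausdorff.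
  by apply: compact_setX; exact: segment_compact.
by apply: filterS => y; exact: F0.
Qed.

(** Each line parallel to [e] meets the half-plane in a half-line because [A] is nonzero; its
    endpoint, where [ell] vanishes, has coordinate -(B t + C)/A. The one-dimensional formula is then
    integrated over t. *)
Lemma integral_derive_halfplane pt e (F ell : R * R -> R) (M A B C : R) :
  is_axis pt e -> C1 e F -> (forall x, ~ square M x -> F x = 0) ->
  continuous ell -> (forall s t, ell (pt s t) = A * s + B * t + C) -> A != 0 ->
  (\int[mu2]_(x in [set x | (0 < ell x)%R]) ('D_e F x)%:E =
   \int[mu]_t (- Num.sg A * F (pt (- (B * t + C) / A) t))%:E)%E.
Proof.
move=> ax C1F F0 cl lE A0.
have [cF dF cDF] := C1F.
have mH : measurable [set x | 0 < ell x].
  apply: open_measurable_plane.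
  by apply: (@open_comp _ _ ell [set y | 0 < y]); [move=> x _; exact: cl|exact: open_gt].
have DF0 := derive_support_square e F0.
rewrite integral_mkcond; rewrite (restrict_EFin ('D_e F : R * R -> R)) (@fubini_axis pt e)//; last first.
  have [K K0 DFK] := continuous_bounded_square M cDF.
  apply: (@bounded_support_integrable _ _ M K) => //.
  - apply/(measurable_restrictT _ _).1 => //.
    by apply: measurable_funTS; exact: continuous_measurable_plane.
  - by move=> x /DF0 Dx; rewrite patchE Dx; case: ifP.
  - by move=> x Mx; rewrite patchE; case: ifP => _; [exact: DFK|rewrite normr0].
apply: eq_integral => t _.
have [C1s DE] := C1_slice t ax C1F.
transitivity (\int[mu]_(s in [set s | (0 < A * s + (B * t + C))%R])
  ('D_(1 : R) (fun s => F (pt s t)) s)%:E)%E.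
  rewrite [RHS]integral_mkcond; apply: eq_integral => s _.
  rewrite !patchE (in_setb (fun x => 0 < ell x)).
  rewrite (in_setb (fun s => 0 < A * s + (B * t + C))) lE addrA.
  by case: ifP => // _; rewrite DE.
rewrite (@integral_derive_halfline _ M)// => s Ms.
apply: F0; move: ax Ms => [[_ ->]|[_ ->]] Ms [] /=; rewrite !in_itv/= -!ler_norml.
- by rewrite leNgt Ms.
- by move=> _; rewrite leNgt Ms.
Qed.

Lemma integral_derive_plane pt e (F : R * R -> R) (M : R) :
  is_axis pt e -> C1 e F -> (forall x, ~ square M x -> F x = 0) ->
  (\int[mu2]_x ('D_e F x)%:E = 0)%E.
Proof.
move=> ax C1F F0.
have [cF dF cDF] := C1F.
have DF0 := derive_support_square e F0.
rewrite (@fubini_axis pt e)//; last first.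
  have [K K0 DFK] := continuous_bounded_square M cDF.
  apply: (@bounded_support_integrable _ _ M K) => //.
  exact: continuous_measurable_plane.
rewrite (eq_integral (cst 0%E)) ?integral0// => t _.
have [C1s DE] := C1_slice t ax C1F.
transitivity (\int[mu]_s ('D_(1 : R) (fun s => F (pt s t)) s)%:E)%E.
  by apply: eq_integral => s _; rewrite DE.
rewrite (@integral_derive_line _ M)// => s Ms.
apply: F0; move: ax Ms => [[_ ->]|[_ ->]] Ms [] /=; rewrite !in_itv/= -!ler_norml.
- by rewrite leNgt Ms.
- by move=> _; rewrite leNgt Ms.
Qed.

End Deriv.

(** * Smooth and C^1 functions *)

Section Smooth.
Variable R : realType.
Implicit Types (f g : R * R -> R).

Lemma CkS n f : Ck n.+1 f -> Ck n f.
Proof.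
elim: n f => [|n IH] f; first by case.
move=> [cf [d1 d2 D1 D2]]; split; first exact: cf.
by split; [exact: d1|exact: d2|exact: IH D1|exact: IH D2].
Qed.

Lemma Ck_cst n (c : R) : Ck n (cst c : R * R -> R).
Proof.
elim: n c => [|n IH] c; split => //; try by move=> x; exact: cvg_cst.
have D e : 'D_e (cst c : R * R -> R) = cst 0.
  by apply/funext => x; rewrite derive_cst.
split; try by move=> x; exact: derivable_cst.
- by rewrite D.
- by rewrite D.
Qed.

Lemma CkD n f g : Ck n f -> Ck n g -> Ck n (fun x => f x + g x).
Proof.
elim: n f g => [|n IH] f g [cf Cf] [cg Cg].
  by split => // x; apply: cvgD; [exact: cf|exact: cg].
split; first by move=> x; apply: cvgD; [exact: cf|exact: cg].
case: Cf => f1 f2 Df1 Df2; case: Cg => g1 g2 Dg1 Dg2.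
split.
- by move=> x; exact: (derivableD (f1 x) (g1 x)).
- by move=> x; exact: (derivableD (f2 x) (g2 x)).
- rewrite (_ : 'D_(e1 R) _ = fun x => 'D_(e1 R) f x + 'D_(e1 R) g x); first exact: IH.
  by apply/funext => x; exact: (deriveD (f1 x) (g1 x)).
- rewrite (_ : 'D_(e2 R) _ = fun x => 'D_(e2 R) f x + 'D_(e2 R) g x); first exact: IH.
  by apply/funext => x; exact: (deriveD (f2 x) (g2 x)).
Qed.

Lemma CkM n f g : Ck n f -> Ck n g -> Ck n (fun x => f x * g x).
Proof.
elim: n f g => [|n IH] f g Cf Cg.
  have [cf _] := Cf; have [cg _] := Cg.
  by split => // x; apply: cvgM; [exact: cf|exact: cg].
have Cf' := CkS Cf; have Cg' := CkS Cg.
have [cf [f1 f2 Df1 Df2]] := Cf; have [cg [g1 g2 Dg1 Dg2]] := Cg.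
split; first by move=> x; apply: cvgM; [exact: cf|exact: cg].
split.
- by move=> x; exact: (derivableM (f1 x) (g1 x)).
- by move=> x; exact: (derivableM (f2 x) (g2 x)).
- rewrite (_ : 'D_(e1 R) _ = fun x => f x * 'D_(e1 R) g x + g x * 'D_(e1 R) f x).
    by apply: CkD; exact: IH.
  by apply/funext => x; exact: (deriveM (f1 x) (g1 x)).
- rewrite (_ : 'D_(e2 R) _ = fun x => f x * 'D_(e2 R) g x + g x * 'D_(e2 R) f x).
    by apply: CkD; exact: IH.
  by apply/funext => x; exact: (deriveM (f2 x) (g2 x)).
Qed.

Lemma smooth_cst (c : R) : smooth (cst c : R * R -> R).
Proof. by move=> n; exact: Ck_cst. Qed.

Lemma smoothD f g : smooth f -> smooth g -> smooth (fun x => f x + g x).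
Proof. by move=> sf sg n; exact: CkD. Qed.

Lemma smoothM f g : smooth f -> smooth g -> smooth (fun x => f x * g x).
Proof. by move=> sf sg n; exact: CkM. Qed.

Lemma is_derive_affine (A B C : R) (x e : R * R) :
  is_derive x e (fun y : R * R => A * y.1 + B * y.2 + C : R) (A * e.1 + B * e.2).
Proof.
have E : (fun h : R => h^-1 *: (((fun y : R * R => A * y.1 + B * y.2 + C) \o shift x) (h *: e)
     - (A * x.1 + B * x.2 + C)))  @ 0^' --> A * e.1 + B * e.2.
  apply: cvg_near_cst; apply: filterS (nbhs_dnbhs_neq _) => h h0 /=.
  rewrite -![h *: _]/(h * _) -[_ *: (_ - _)]/(_ * _); field.
  exact: h0.
apply: DeriveDef; first by apply/cvg_ex; exists (A * e.1 + B * e.2).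
exact: cvg_lim E.
Qed.

Lemma continuous_affine (A B C : R) :
  continuous (fun y : R * R => A * y.1 + B * y.2 + C : R).
Proof.
move=> x; apply: cvgD; last exact: cvg_cst.
by apply: cvgD; apply: cvgM; try exact: cvg_cst; [exact: cvg_fst|exact: cvg_snd].
Qed.

Lemma C1_affine (A B C : R) e : C1 e (fun y : R * R => A * y.1 + B * y.2 + C : R).
Proof.
split.
- exact: continuous_affine.
- by move=> x; have := is_derive_affine A B C x e; case.
- rewrite (_ : 'D_e _ = cst (A * e.1 + B * e.2)); first by move=> x; exact: cvg_cst.
  by apply/funext => x; have := is_derive_affine A B C x e; case.
Qed.

Lemma smooth_affine (A B C : R) : smooth (fun y : R * R => A * y.1 + B * y.2 + C : R).
Proof.
have D e : 'D_e (fun y : R * R => A * y.1 + B * y.2 + C : R) = cst (A * e.1 + B * e.2).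
  by apply/funext => x; have := is_derive_affine A B C x e; case.
have [cl d1 _] := C1_affine A B C (e1 R); have [_ d2 _] := C1_affine A B C (e2 R).
by case=> [|n]; split => //; rewrite !D; split => //; exact: Ck_cst.
Qed.

Lemma smooth_C1 pt e f : is_axis pt e -> smooth f -> C1 e f.
Proof.
move=> ax /(_ 1) [cf [d1 d2 [c1 _] [c2 _]]].
case: ax => -[-> _].
  by split; [exact: cf|exact: d1|exact: c1].
by split; [exact: cf|exact: d2|exact: c2].
Qed.

(** The positive part is squared to make the truncation C^1: its derivative also vanishes at 0. *)
Definition sqpos (x : R) : R := Num.max x 0 ^+ 2.

Lemma sqpos_le0 x : x <= 0 -> sqpos x = 0.
Proof. by move=> x0; rewrite /sqpos max_r// expr0n. Qed.

(** Whatever the signs of x and x + h, the first-order remainder is at most h^2, hence the error of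
    the difference quotient is at most |h|. *)
Lemma is_derive_sqpos (x : R) : is_derive x (1 : R) sqpos (2 * Num.max x 0).
Proof.
have rem h : `|sqpos (h + x) - sqpos x - 2 * Num.max x 0 * h| <= h ^+ 2.
  rewrite /sqpos; case: (leP x 0) => x0; case: (leP (h + x) 0) => hx0;
    rewrite ler_norml; apply/andP; split; nra.
have E : (fun h : R => h^-1 *: ((sqpos \o shift x) (h *: (1 : R)) - sqpos x)) @ 0^'
    --> 2 * Num.max x 0.
  apply/subr_cvg0.
  apply: norm_cvg0.
  apply: (@squeeze_cvgr _ _ _ _ (cst 0) (fun h : R => `|h|)).
  - apply: filterS (nbhs_dnbhs_neq _) => h h0 /=; rewrite normr_ge0/=.
    rewrite -[_ *: (_ - _)]/(_ * _) -[h *: _]/(h * 1) mulr1.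
    have -> : h^-1 * (sqpos (h + x) - sqpos x) - 2 * Num.max x 0 =
       h^-1 * (sqpos (h + x) - sqpos x - 2 * Num.max x 0 * h).
      by field.
    rewrite normrM normfV ler_pdivrMl ?normr_gt0// -normrM -expr2 (le_trans (rem h))//.
    by rewrite ler_norm.
  - exact: cvg_cst.
  - rewrite -[X in _ --> X](normr0 R); apply: cvg_within_filter.
    exact: norm_continuous.
apply: DeriveDef; first by apply/cvg_ex; exists (2 * Num.max x 0).
exact: cvg_lim E.
Qed.

Lemma C1_sqpos : C1 (1 : R) sqpos.
Proof.
have d x : derivable sqpos x (1 : R) by have := is_derive_sqpos x; case.
have c (x : R) : {for x, continuous sqpos}.
  by apply: differentiable_continuous; apply/derivable1_diffP; exact: d.
split => //.
rewrite (_ : 'D_(1 : R) _ = fun x : R => 2 * Num.max x 0); last first.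
  by apply/funext => x; have := is_derive_sqpos x; case.
move=> x; apply: cvgM; first exact: cvg_cst.
by apply: continuous_max; [exact: cvg_id|exact: cvg_cst].
Qed.

Lemma derive_sqpos x : x <= 0 -> 'D_(1 : R) sqpos x = 0.
Proof.
by move=> x0; have [_ ->] := is_derive_sqpos x; rewrite max_r// mulr0.
Qed.

(** Since [l] is derivable along [e] only, the chain rule is applied to the one-variable function h
    |-> l (h e + x). *)
Lemma C1_comp (f : R -> R) (l : R * R -> R) e : C1 (1 : R) f -> C1 e l ->
  C1 e (fun x => f (l x)) /\
  (forall x, 'D_e (fun y => f (l y)) x = 'D_(1 : R) f (l x) * 'D_e l x).
Proof.
move=> [cf df cDf] [cl dl cDl].
have dG x : derivable (fun h : R => l (h *: e + x)) 0 (1 : R).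
  by apply/(derivable1P l x e); exact: dl.
have derive_ray (F : R * R -> R) x : 'D_e F x = derive1 (fun h : R => F (h *: e + x)) 0.
  rewrite /derive /derive1.
  by under [in RHS]eq_fun do rewrite addr0 scale0r add0r.
have dcomp x : derivable (fun y => f (l y)) x e.
  apply/derivable1P/derivable1_diffP.
  apply: (@differentiable_comp _ _ _ _ (fun h : R => l (h *: e + x)) f).
    by apply/derivable1_diffP; exact: dG.
  by apply/derivable1_diffP; exact: df.
have DE x : 'D_e (fun y => f (l y)) x = 'D_(1 : R) f (l x) * 'D_e l x.
  rewrite !derive_ray (derive1_comp (dG x) (df _)) derive1E.
  by rewrite scale0r add0r.
split; last exact: DE.
split.
- by move=> x; apply: (cvg_comp l f (cl x)); exact: cf.
- exact: dcomp.
- rewrite (_ : 'D_e _ = fun x => 'D_(1 : R) f (l x) * 'D_e l x); last exact/funext.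
  move=> x; apply: cvgM; last exact: cDl.
  by apply: (cvg_comp l ('D_(1 : R) f) (cl x)); exact: cDf.
Qed.

End Smooth.

(** * Affine change of variable on the line *)

Section Substitution.
Variable R : realType.
Local Notation mu := (@lebesgue_measure R).

Lemma is_derive_affine1 (u d t : R) : is_derive t (1 : R) (fun t : R => u + t * d) d.
Proof.
have E : (fun h : R => h^-1 *: (((fun t : R => u + t * d) \o shift t) (h *: (1 : R))
     - (u + t * d)))  @ 0^' --> d.
  apply: cvg_near_cst; apply: filterS (nbhs_dnbhs_neq _) => h h0 /=.
  rewrite -[h *: _]/(h * _) -[_ *: (_ - _)]/(_ * _); field.
  exact: h0.
apply: DeriveDef; first by apply/cvg_ex; exists d.
exact: cvg_lim E.
Qed.

Lemma derive1_affine (u d : R) : derive1 (fun t : R => u + t * d) = cst d.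
Proof.
by apply/funext => t; rewrite derive1E; have [_ ->] := is_derive_affine1 u d t.
Qed.

Lemma derivable_oo_affine (u d a b : R) : derivable_oo_LRcontinuous (fun t : R => u + t * d) a b.
Proof.
have cF : continuous (fun t : R => u + t * d).
  by move=> t; apply: cvgD; [exact: cvg_cst|apply: cvgM; [exact: cvg_id|exact: cvg_cst]].
split.
- by move=> t _; have [] := is_derive_affine1 u d t.
- by apply: cvg_at_right_filter; exact: cF.
- by apply: cvg_at_left_filter; exact: cF.
Qed.

(** Used to pass from a coordinate along a side to arc length. The endpoints [u] and [v] come in
    either order, whence the absolute value in the Jacobian and the two monotone cases. *)
Lemma integral_affine_substitution (g : R -> R) (u v L : R) : continuous g ->
  0 < L -> u != v -> (forall t, ~~ (Num.min u v <= t <= Num.max u v) -> g t = 0) ->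
  (\int[mu]_t (g t)%:E =
   \int[mu]_(t in `[0%R, L]) (`|v - u| / L * g (u + t / L * (v - u)))%:E)%E.
Proof.
move=> cg L0 uv g0.
pose d := (v - u) / L.
have FE t : u + t / L * (v - u) = u + t * d by rewrite /d; ring.
have FL : u + L * d = v by rewrite /d; field; rewrite gt_eqF.
have F0 : u + 0 * d = u by rewrite mul0r addr0.
have absd : `|v - u| / L = `|d| by rewrite /d normrM normfV (gtr0_norm L0).
have F'E := derive1_affine u d.
under [RHS]eq_integral do rewrite FE absd.
have restrict_uv a b : Num.min u v = a -> Num.max u v = b ->
    (\int[mu]_t (g t)%:E = \int[mu]_(t in `[a, b]) (g t)%:E)%E.
  move=> ua vb; rewrite [RHS]integral_mkcond; apply: eq_integral => t _.
  rewrite patchE mem_setE in_itv/=; case: ifPn => //.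
  by rewrite -ua -vb => /g0 ->.
have [ltuv|ltvu|/eqP] := ltgtP u v; last by rewrite (negbTE uv).
- have d0 : 0 < d by rewrite divr_gt0// subr_gt0.
  rewrite (restrict_uv u v) ?min_l ?max_r 1?ltW//.
  rewrite -{1}F0 -{1}FL (@integration_by_substitution_increasing _ (fun t => u + t * d))//; first last.
  - by rewrite F0 FL; apply: continuous_subspaceT.
  - exact: derivable_oo_affine.
  - by rewrite F'E; exact: is_cvg_cst.
  - by rewrite F'E; exact: is_cvg_cst.
  - by move=> t _; rewrite F'E; exact: cvg_cst.
  - by move=> x y _ _ xy; rewrite ltrD2l ltr_pM2r.
  - exact: ltW.
  apply: eq_integral => t _ /=; rewrite F'E (gtr0_norm d0).
  by rewrite -[(_ * _) t]/(_ * _) mulrC.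
- have d0 : d < 0 by rewrite ltr_pdivrMr// mul0r subr_lt0.
  rewrite (restrict_uv v u) ?min_r ?max_l 1?ltW//.
  rewrite -{1}F0 -{1}FL (@integration_by_substitution_decreasing _ (fun t => u + t * d))//; first last.
  - by rewrite F0 FL; apply: continuous_subspaceT.
  - exact: derivable_oo_affine.
  - by rewrite F'E; exact: is_cvg_cst.
  - by rewrite F'E; exact: is_cvg_cst.
  - by move=> t _; rewrite F'E; exact: cvg_cst.
  - by move=> x y _ _ xy; rewrite ltrD2l ltr_nM2r.
  - exact: ltW.
  apply: eq_integral => t _ /=; rewrite F'E (ltr0_norm d0).
  by rewrite -[(_ * _) t]/(_ * _) mulrC.
Qed.

End Substitution.

(** * Green's formula on a triangle *)

Section Triangle.
Variable R : realType.
Implicit Types (p q r x : R * R).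
Local Notation mu := (@lebesgue_measure R).
Local Notation mu2 := (mu \x mu)%E.
Local Notation edist := (@Defs.edist R).

Definition det3 p q r : R := (q.1 - p.1) * (r.2 - p.2) - (q.2 - p.2) * (r.1 - p.1).

(* The barycentric coordinate of [x] relative to [p]; those relative to [q] and
   [r] are obtained by rotating the arguments. *)
Definition bary p q r x : R := det3 x q r / det3 p q r.

Lemma det3_rot p q r : det3 q r p = det3 p q r.
Proof. by rewrite /det3; ring. Qed.

Lemma bary_affine p q r : bary p q r =
  fun x => (q.2 - r.2) / det3 p q r * x.1 + (r.1 - q.1) / det3 p q r * x.2
           + (q.1 * r.2 - q.2 * r.1) / det3 p q r.
Proof. by apply/funext => x; rewrite /bary {1}/det3; ring. Qed.

Lemma smooth_bary p q r : smooth (bary p q r).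
Proof. by rewrite bary_affine; exact: smooth_affine. Qed.

Lemma continuous_bary p q r : continuous (bary p q r).
Proof. by rewrite bary_affine; exact: continuous_affine. Qed.

Lemma bary_sum p q r x : det3 p q r != 0 ->
  bary p q r x + bary q r p x + bary r p q x = 1.
Proof.
move=> D0; rewrite /bary (det3_rot q r p) (det3_rot p q r) -!mulrDl.
by apply: (mulIf D0); rewrite divfK// mul1r /det3; ring.
Qed.

Lemma bary_comb p q r x : det3 p q r != 0 ->
  x = bary p q r x *: p + bary q r p x *: q + bary r p q x *: r.
Proof.
move=> D0; rewrite /bary (det3_rot q r p) (det3_rot p q r).
have E (y z t : R) (a b c d : R) : a * y + b * z + c * t = d * det3 p q r ->
    d = a / det3 p q r * y + b / det3 p q r * z + c / det3 p q r * t.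
  move=> H; apply: (mulIf D0); rewrite -H !mulrDl.
  by congr (_ + _ + _); rewrite mulrAC divfK.
case: x => x1 x2; congr pair => /=; rewrite -![_ *: _]/(_ * _); apply: E; rewrite /det3/=; ring.
Qed.

Lemma bary_of_comb p q r (a b c : R) : det3 p q r != 0 -> a + b + c = 1 ->
  bary p q r (a *: p + b *: q + c *: r) = a.
Proof.
move=> D0 abc; have -> : a = 1 - b - c by rewrite -abc; ring.
apply: (canLR (mulfK D0)).
by rewrite /det3/= -![_ *: _]/(_ * _); ring.
Qed.

(** The coefficients of an affine combination of the vertices are its barycentric coordinates, so
    the triangle is an intersection of three open half-planes. *)
Lemma open_triangleE p q r : det3 p q r != 0 ->
  open_triangle p q r =
  [set x | [/\ 0 < bary p q r x, 0 < bary q r p x & 0 < bary r p q x]].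
Proof.
move=> D0; have Dq : det3 q r p != 0 by rewrite det3_rot.
have Dr : det3 r p q != 0 by rewrite -det3_rot.
apply/seteqP; split => x.
- move=> [a [b [c [a0 b0 c0 abc ->]]]]; split.
  + by rewrite bary_of_comb.
  + have -> : a *: p + b *: q + c *: r = b *: q + c *: r + a *: p by rewrite -addrA addrC.
    by rewrite bary_of_comb// -abc; ring.
  + have -> : a *: p + b *: q + c *: r = c *: r + a *: p + b *: q by rewrite addrC addrA.
    by rewrite bary_of_comb// -abc; ring.
- move=> [a0 b0 c0]; exists (bary p q r x), (bary q r p x), (bary r p q x); split => //.
    exact: bary_sum.
  exact: bary_comb.
Qed.

Lemma open_triangle_rot p q r : det3 p q r != 0 ->
  open_triangle q r p = open_triangle p q r.
Proof.
move=> D0; rewrite open_triangleE; last by rewrite det3_rot.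
rewrite open_triangleE; last exact: D0.
by apply/seteqP; split => x [].
Qed.

(** The factor 2 makes the square contain not only the triangle but every point with barycentric
    coordinates at most 2 in absolute value, hence the support of the weights below. *)
Definition radius p q r : R :=
  2 * (`|p.1| + `|q.1| + `|r.1| + `|p.2| + `|q.2| + `|r.2|).

Lemma bary_square p q r x : det3 p q r != 0 ->
  `|bary p q r x| <= 2 -> `|bary q r p x| <= 2 -> `|bary r p q x| <= 2 ->
  square (radius p q r) x.
Proof.
move=> D0 bp bq br; rewrite (bary_comb x D0).
set a := bary p q r x in bp *; set b := bary q r p x in bq *; set c := bary r p q x in br *.
have E (u v w : R) : `|a * u + b * v + c * w| <= 2 * (`|u| + `|v| + `|w|).
  rewrite (le_trans (ler_normD _ _))// mulrDr lerD//.
    rewrite (le_trans (ler_normD _ _))// mulrDr lerD// normrM ler_wpM2r//.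
  by rewrite normrM ler_wpM2r.
split; rewrite /= in_itv/= -ler_norml -![_ *: _]/(_ * _) (le_trans (E _ _ _))// /radius ler_pM2l//.
  by have := normr_ge0 p.2; have := normr_ge0 q.2; have := normr_ge0 r.2; lra.
by have := normr_ge0 p.1; have := normr_ge0 q.1; have := normr_ge0 r.1; lra.
Qed.

Lemma open_triangle_square p q r : det3 p q r != 0 ->
  open_triangle p q r `<=` square (radius p q r).
Proof.
move=> D0 x; rewrite open_triangleE// => -[a0 b0 c0].
have s := bary_sum x D0.
by apply: bary_square; rewrite ?gtr0_norm//; lra.
Qed.

Lemma open_open_triangle p q r : det3 p q r != 0 -> open (open_triangle p q r).
Proof.
move=> D0; rewrite open_triangleE//.
have o (l : R * R -> R) : continuous l -> open [set x | 0 < l x].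
  by move=> cl; apply: (@open_comp _ _ l [set y | 0 < y]); [move=> x _; exact: cl|exact: open_gt].
rewrite (_ : [set x | _] = [set x | 0 < bary p q r x] `&`
  [set x | 0 < bary q r p x] `&` [set x | 0 < bary r p q x]).
  by apply: openI; [apply: openI|]; apply: o; exact: continuous_bary.
by apply/seteqP; split => x; [move=> []|move=> [[]]].
Qed.

Lemma measurable_triangle p q r : det3 p q r != 0 -> measurable (open_triangle p q r).
Proof. by move=> D0; apply: open_measurable_plane; exact: open_open_triangle. Qed.

Lemma continuous_integrable_triangle p q r (f : R * R -> R) : det3 p q r != 0 ->
  continuous f -> mu2.-integrable (open_triangle p q r) (EFin \o f).
Proof.
move=> D0 cf; have [K _ fK] := continuous_bounded_square (radius p q r) cf.
apply: (@bounded_integrable_plane _ _ _ (radius p q r) K).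
- exact: measurable_triangle.
- exact: open_triangle_square.
- by apply: measurable_funTS; exact: continuous_measurable_plane.
- by move=> x /(open_triangle_square D0); exact: fK.
Qed.

Lemma continuous_L2_triangle p q r (f : R * R -> R) : det3 p q r != 0 ->
  continuous f -> L2 (open_triangle p q r) f.
Proof.
move=> D0 cf; have [K _ fK] := continuous_bounded_square (radius p q r) cf.
apply: (@bounded_L2_plane _ _ _ (radius p q r) K).
- exact: measurable_triangle.
- exact: open_triangle_square.
- by apply: measurable_funTS; exact: continuous_measurable_plane.
- by move=> x /(open_triangle_square D0); exact: fK.
Qed.

Lemma edist_gt0 p q r : det3 p q r != 0 -> 0 < edist q r.
Proof.
move=> D0; rewrite sqrtr_gt0 lt0r addr_ge0 ?sqr_ge0// andbT.
rewrite paddr_eq0 ?sqr_ge0// !sqrf_eq0 !subr_eq0; apply: contra D0 => /andP[/eqP e1 /eqP e2].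
by rewrite /det3 e1 e2; apply/eqP; ring.
Qed.

Lemma seg_comb q r (t : R) : seg q r t = (1 - t / edist q r) *: q + (t / edist q r) *: r.
Proof. by rewrite /seg scalerBr scalerBl scale1r addrA addrAC. Qed.

Lemma bary_seg p q r t : det3 p q r != 0 ->
  [/\ bary p q r (seg q r t) = 0, bary q r p (seg q r t) = 1 - t / edist q r
    & bary r p q (seg q r t) = t / edist q r].
Proof.
move=> D0; rewrite seg_comb; set s := t / edist q r.
have Dq : det3 q r p != 0 by rewrite det3_rot.
have Dr : det3 r p q != 0 by rewrite -det3_rot.
split.
- have -> : (1 - s) *: q + s *: r = 0 *: p + (1 - s) *: q + s *: r by rewrite scale0r add0r.
  by rewrite bary_of_comb//; ring.
- have -> : (1 - s) *: q + s *: r = (1 - s) *: q + s *: r + 0 *: p by rewrite scale0r addr0.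
  by rewrite bary_of_comb//; ring.
- have -> : (1 - s) *: q + s *: r = s *: r + 0 *: p + (1 - s) *: q by rewrite scale0r addr0 addrC.
  by rewrite bary_of_comb//; ring.
Qed.

(* Truncating with [sqpos] makes the product C^1 on the whole plane and zero on
   the half-plane [bary p q r > 0] outside the triangle, so that Green's formula
   on the triangle reduces to the half-plane. *)
Definition weight p q r (k : R) x : R :=
  sqpos (bary q r p x) * sqpos (bary r p q x) * sqpos (1 - (k * bary p q r x) ^+ 2).

Lemma C1_cutoff pt e p q r k : is_axis pt e -> C1 e (fun x => 1 - (k * bary p q r x) ^+ 2).
Proof.
move=> ax; apply: (smooth_C1 ax).
rewrite (_ : (fun x => _) = fun x => cst 1 x + cst (- k ^+ 2) x * (bary p q r x * bary p q r x)).
  apply: smoothD; first exact: smooth_cst.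
  apply: smoothM; first exact: smooth_cst.
  by apply: smoothM; exact: smooth_bary.
by apply/funext => x /=; ring.
Qed.

Lemma C1_weight pt e p q r k : is_axis pt e -> C1 e (weight p q r k).
Proof.
move=> ax; have C1b p' q' r' : C1 e (bary p' q' r') := smooth_C1 ax (smooth_bary p' q' r').
have C1k := C1_cutoff p q r k ax.
have C1s := C1_sqpos R.
have [C1q _] := C1_comp C1s (C1b q r p).
have [C1r _] := C1_comp C1s (C1b r p q).
have [C1k' _] := C1_comp C1s C1k.
have [C1qr _] := C1M C1q C1r.
by have [] := C1M C1qr C1k'.
Qed.

(** Both [sqpos] and its derivative vanish on the nonpositive reals, so both terms of the product
    rule do; the line [l x = 0] is included. *)
Lemma derive_sqpos_vanish (e : R * R) (G l : R * R -> R) x : C1 e G -> C1 e l -> l x <= 0 ->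
  'D_e (fun x => G x * sqpos (l x)) x = 0.
Proof.
move=> CG Cl lx.
have [C1s Ds] := C1_comp (C1_sqpos R) Cl.
have [_ ->] := C1M CG C1s.
by rewrite Ds derive_sqpos// sqpos_le0// !mul0r mulr0 addr0.
Qed.

(** Where the weight is nonzero, the coordinate of p is less than 1/k <= 1 in absolute value and the
    other two are positive. As the three add up to 1, all are bounded by 2, uniformly in k. *)
Lemma weight_square p q r k x : det3 p q r != 0 -> 1 <= k -> ~ square (radius p q r) x ->
  weight p q r k x = 0.
Proof.
move=> D0 k1 nx; rewrite /weight.
have [bq|bq] := leP (bary q r p x) 0; first by rewrite sqpos_le0// !mul0r.
have [br|br] := leP (bary r p q x) 0; first by rewrite (sqpos_le0 br) mulr0 mul0r.
have [bk|bk] := leP (1 - (k * bary p q r x) ^+ 2) 0; first by rewrite (sqpos_le0 bk) mulr0.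
exfalso; apply: nx.
have s := bary_sum x D0.
have bp : `|bary p q r x| < 1.
  rewrite -(expr_lt1 (n := 2))// -normrX ger0_norm ?sqr_ge0//.
  apply: le_lt_trans (_ : (k * bary p q r x) ^+ 2 < 1); last by rewrite -subr_gt0.
  move: (bary p q r x) => b.
  by rewrite exprMn ler_peMl ?sqr_ge0// exprn_ege1.
move: (bp); rewrite ltr_norml => /andP[bp1 bp2].
by apply: bary_square => //; rewrite ?(gtr0_norm bq) ?(gtr0_norm br); lra.
Qed.

Lemma continuous_pairR (f g : R -> R) : continuous f -> continuous g ->
  continuous (fun t => (f t, g t)).
Proof.
move=> cf cg t.
by apply: (@cvg_pair _ _ _ (nbhs t) (nbhs (f t)) (nbhs (g t)) _ _ _ f g); [exact: cf|exact: cg].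
Qed.

Lemma affine_line (A B C t : R) : - (B * x + C) / A @[x --> t] --> - (B * t + C) / A.
Proof.
apply: cvgM; last exact: cvg_cst.
apply: cvgN; apply: cvgD; last exact: cvg_cst.
by apply: cvgM; [exact: cvg_cst|exact: cvg_id].
Qed.

(** Rewrites the boundary term of the half-plane formula, an integral over the whole line through q
    and r, as an arc-length integral over the side. The two vanishing conditions on [F] remove the
    rest of the line. *)
Lemma side_integral p q r : det3 p q r != 0 ->
  exists pt e (A B C kappa : R), [/\ is_axis pt e, A != 0, kappa != 0,
    forall s t, bary p q r (pt s t) = A * s + B * t + C &
    forall F : R * R -> R, continuous F ->
      (forall x, bary q r p x <= 0 -> F x = 0) -> (forall x, bary r p q x <= 0 -> F x = 0) ->
      (\int[mu]_t (- Num.sg A * F (pt (- (B * t + C) / A) t))%:E =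
       \int[mu]_(t in `[0%R, edist q r]) (kappa * F (seg q r t))%:E)%E].
Proof.
move=> D0.
have L0 := edist_gt0 D0.
(* Common to both axes: [u] and [v] are the coordinates of q and r on the axis other than [e], which
   parametrizes the line. *)
have main pt e (A B C u v : R) : is_axis pt e -> A != 0 -> u != v ->
    (forall s t, bary p q r (pt s t) = A * s + B * t + C) ->
    (forall t, bary q r p (pt (- (B * t + C) / A) t) = (t - v) / (u - v)) ->
    (forall t, bary r p q (pt (- (B * t + C) / A) t) = (t - u) / (v - u)) ->
    (forall s, pt (- (B * (u + s * (v - u)) + C) / A) (u + s * (v - u)) = q + s *: (r - q)) ->
    continuous (fun t => pt (- (B * t + C) / A) t) ->
  exists pt e (A B C kappa : R), [/\ is_axis pt e, A != 0, kappa != 0,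
    forall s t, bary p q r (pt s t) = A * s + B * t + C &
    forall F : R * R -> R, continuous F ->
      (forall x, bary q r p x <= 0 -> F x = 0) -> (forall x, bary r p q x <= 0 -> F x = 0) ->
      (\int[mu]_t (- Num.sg A * F (pt (- (B * t + C) / A) t))%:E =
       \int[mu]_(t in `[0%R, edist q r]) (kappa * F (seg q r t))%:E)%E].
  move=> ax A0 uv bE bq br ptE cpt.
  (* The Jacobian of the passage to arc length, times the sign left by the half-plane formula. *)
  exists pt, e, A, B, C, (`|v - u| / edist q r * - Num.sg A); split => //.
    have vu : v - u != 0 by rewrite subr_eq0 eq_sym.
    have Li : (edist q r)^-1 != 0 by rewrite invr_eq0 gt_eqF.
    by rewrite !mulf_neq0 ?normr_eq0 ?oppr_eq0 ?sgr_eq0.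
  move=> F cF Fq Fr.
  rewrite (@integral_affine_substitution _
    (fun t => - Num.sg A * F (pt (- (B * t + C) / A) t)) u v (edist q r))//.
  - apply: eq_integral => t _; rewrite ptE /seg.
    by congr EFin; ring.
  - move=> t; apply: cvgM; first exact: cvg_cst.
    by apply: (cvg_comp (fun t => pt (- (B * t + C) / A) t) F (cpt t)); exact: cF.
  (* Beyond q the coordinate of r is nonpositive, beyond r that of q is; [F] vanishes in either
     case. *)
  - move=> t tuv; have [ltuv|ltvu|/eqP] := ltgtP u v; last by rewrite (negbTE uv).
      rewrite (min_l (ltW ltuv)) (max_r (ltW ltuv)) negb_and -!ltNge in tuv.
      move: tuv => /orP[tu|vt].
        rewrite Fr ?mulr0// br.
        by rewrite mulr_le0_ge0 ?invr_ge0 ?subr_le0 ?subr_ge0 ?(ltW tu) ?(ltW ltuv).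
      rewrite Fq ?mulr0// bq.
      by rewrite mulr_ge0_le0 ?invr_le0 ?subr_le0 ?subr_ge0 ?(ltW vt) ?(ltW ltuv).
    rewrite (min_r (ltW ltvu)) (max_l (ltW ltvu)) negb_and -!ltNge in tuv.
    move: tuv => /orP[tu|vt].
      rewrite Fq ?mulr0// bq.
      by rewrite mulr_le0_ge0 ?invr_ge0 ?subr_le0 ?subr_ge0 ?(ltW tu) ?(ltW ltvu).
    rewrite Fr ?mulr0// br.
    by rewrite mulr_ge0_le0 ?invr_le0 ?subr_le0 ?subr_ge0 ?(ltW vt) ?(ltW ltvu).
(* A horizontal side requires the vertical axis; for any other side the horizontal axis is
   transversal. *)
have [E2|N2] := eqVneq q.2 r.2.
- have N1 : q.1 != r.1.
    by apply: contra D0 => /eqP E1; rewrite /det3 E1 E2; apply/eqP; ring.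
  have N1' : r.1 - q.1 != 0 by rewrite subr_eq0 eq_sym.
  have N1'' : q.1 - r.1 != 0 by rewrite subr_eq0.
  apply: (@main (fun s t => (t, s)) (e2 R) ((r.1 - q.1) / det3 p q r) ((q.2 - r.2) / det3 p q r)
    ((q.1 * r.2 - q.2 * r.1) / det3 p q r) q.1 r.1).
  + by right.
  + by rewrite mulf_neq0 ?invr_eq0.
  + by [].
  + by move=> s t; rewrite bary_affine/=; ring.
  + move=> t; rewrite bary_affine/= (det3_rot p q r).
    rewrite /det3 in D0 *; field.
    by rewrite D0 N1' N1''.
  + move=> t; rewrite bary_affine/= -(det3_rot r p q).
    rewrite /det3 in D0 *; field.
    by rewrite D0 N1'.
  + move=> s; rewrite [RHS]surjective_pairing; congr pair => /=.
    rewrite -[s *: _]/(_ * _) /det3; rewrite /det3 in D0; field.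
    by rewrite D0 N1'.
  + apply: continuous_pairR; first by move=> t; exact: cvg_id.
    by move=> t; exact: affine_line.
- have N1' : r.2 - q.2 != 0 by rewrite subr_eq0 eq_sym.
  have N1'' : q.2 - r.2 != 0 by rewrite subr_eq0.
  apply: (@main (fun s t => (s, t)) (e1 R) ((q.2 - r.2) / det3 p q r) ((r.1 - q.1) / det3 p q r)
    ((q.1 * r.2 - q.2 * r.1) / det3 p q r) q.2 r.2).
  + by left.
  + by rewrite mulf_neq0 ?invr_eq0.
  + by [].
  + by move=> s t; rewrite bary_affine/=; ring.
  + move=> t; rewrite bary_affine/= (det3_rot p q r).
    rewrite /det3 in D0 *; field.
    by rewrite D0 N1''.
  + move=> t; rewrite bary_affine/= -(det3_rot r p q).
    rewrite /det3 in D0 *; field.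
    by rewrite D0 N1' N1''.
  + move=> s; rewrite [RHS]surjective_pairing; congr pair => /=.
    rewrite -[s *: _]/(_ * _) /det3; rewrite /det3 in D0; field.
    by rewrite D0 N1''.
  + apply: continuous_pairR; last by move=> t; exact: cvg_id.
    by move=> t; exact: affine_line.
Qed.

Lemma continuous_seg q r : continuous (seg q r).
Proof.
move=> t; apply: cvgD; first exact: cvg_cst.
apply: cvgZ; last exact: cvg_cst.
by apply: cvgM; [exact: cvg_id|exact: cvg_cst].
Qed.

Definition side_weight (L t : R) : R := sqpos (1 - t / L) * sqpos (t / L).

(** The coordinate of p is zero on the side [q, r], so the cutoff factor is [sqpos 1 = 1] for every
    k: all the weights have the same boundary values. *)
Lemma weight_seg p q r k t : det3 p q r != 0 ->
  weight p q r k (seg q r t) = side_weight (edist q r) t.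
Proof.
move=> D0; rewrite /weight; have [-> -> ->] := bary_seg t D0.
by rewrite mulr0 expr0n subr0 /side_weight {3}/sqpos max_l// expr1n mulr1.
Qed.

(** The axis and [kappa] are fixed before [k] and [phi], which allows limits in both with the same
    constant. *)
Lemma green_triangle p q r : det3 p q r != 0 ->
  exists pt e kappa, [/\ is_axis pt e, kappa != 0 &
    forall k (phi : R * R -> R), 1 <= k -> C1 e phi ->
    \int[mu2]_(x in open_triangle p q r)
        (phi x * 'D_e (weight p q r k) x + weight p q r k x * 'D_e phi x) =
    kappa * \int[mu]_(t in `[0, edist q r])
        (phi (seg q r t) * side_weight (edist q r) t)].
Proof.
move=> D0; have [pt [e [A [B [C [kappa [ax A0 kappa0 bE side]]]]]]] := side_integral D0.
exists pt, e, kappa; split => // k phi k1 Cphi.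
have Cw := C1_weight p q r k ax.
have Cb p' q' r' : C1 e (bary p' q' r') := smooth_C1 ax (smooth_bary p' q' r').
have [CF DF] := C1M Cphi Cw.
set F := fun x => phi x * weight p q r k x in CF DF *.
have [cF _ _] := CF.
have F0 x : ~ square (radius p q r) x -> F x = 0.
  by move=> nx; rewrite /F weight_square// mulr0.
have C1s := C1_sqpos R.
have [Csq _] := C1_comp C1s (Cb q r p).
have [Csr _] := C1_comp C1s (Cb r p q).
have Csk : C1 e (fun x => sqpos (1 - (k * bary p q r x) ^+ 2)).
  have [//] := C1_comp C1s (C1_cutoff p q r k ax).
(* The product is reordered so that the vanishing truncation comes last. *)
have DFq x : bary q r p x <= 0 -> 'D_e F x = 0.
  move=> bx; rewrite (_ : F = fun x => (phi x * sqpos (bary r p q x) *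
    sqpos (1 - (k * bary p q r x) ^+ 2)) * sqpos (bary q r p x)).
    have [C1' _] := C1M Cphi Csr.
    have [C1'' _] := C1M C1' Csk.
    exact: (derive_sqpos_vanish C1'' (Cb q r p) bx).
  by apply/funext => y; rewrite /F /weight; ring.
have DFr x : bary r p q x <= 0 -> 'D_e F x = 0.
  move=> bx; rewrite (_ : F = fun x => (phi x * sqpos (bary q r p x) *
    sqpos (1 - (k * bary p q r x) ^+ 2)) * sqpos (bary r p q x)).
    have [C1' _] := C1M Cphi Csq.
    have [C1'' _] := C1M C1' Csk.
    exact: (derive_sqpos_vanish C1'' (Cb r p q) bx).
  by apply/funext => y; rewrite /F /weight; ring.
have Fq x : bary q r p x <= 0 -> F x = 0.
  by move=> bx; rewrite /F /weight sqpos_le0// !mul0r mulr0.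
have Fr x : bary r p q x <= 0 -> F x = 0.
  by move=> bx; rewrite /F /weight (sqpos_le0 bx) mulr0 mul0r mulr0.
(* At a point of the half-plane outside the triangle one of the other two coordinates is
   nonpositive, so the derivative of [F] is zero there. *)
transitivity (\int[mu2]_(x in [set x | 0 < bary p q r x]) ('D_e F x)).
  rewrite Rintegral_mkcond [RHS]Rintegral_mkcond; apply: eq_Rintegral => x _.
  rewrite !patchE -DF open_triangleE//.
  rewrite (in_setb (fun x => 0 < bary p q r x)).
  case: ifPn => [/set_mem [-> _ _]//|].
  rewrite notin_setE/= => nT; case: ifP => // bp.
  have [bq|bq] := leP (bary q r p x) 0; first by rewrite DFq.
  have [br|br] := leP (bary r p q x) 0; first by rewrite DFr.
  by exfalso; apply: nT.
rewrite /Rintegral (@integral_derive_halfplane _ pt e F _ (radius p q r) A B C)//;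
  last exact: continuous_bary.
rewrite side// -[LHS]/(\int[mu]_(t in `[0, edist q r]) (kappa * F (seg q r t))).
have cs : continuous (fun t => F (seg q r t)).
  by move=> t; apply: (cvg_comp (seg q r) F (@continuous_seg q r t)); exact: cF.
rewrite RintegralZl//; last first.
  by apply: continuous_compact_integrable; [exact: segment_compact|exact: continuous_subspaceT].
congr (_ * _); apply: eq_Rintegral => t _.
by rewrite /F weight_seg.
Qed.

End Triangle.

(** * Traces *)

Section Trace.
Variable R : realType.
Implicit Types (p q r x : R * R) (u g phi : R * R -> R).
Local Notation mu := (@lebesgue_measure R).
Local Notation mu2 := (mu \x mu)%E.
Local Notation edist := (@Defs.edist R).

(** The product of [u] and a test function is C^1 along [e] and supported in the triangle; the
    integral of its derivative over the plane is zero, and the product rule gives the two terms. *)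
Lemma smooth_weak_derivative p q r u pt e : det3 p q r != 0 -> smooth u -> is_axis pt e ->
  weak_derivative (open_triangle p q r) e u ('D_e u).
Proof.
move=> D0 su ax phi [sphi _ supp].
have Cu := smooth_C1 ax su; have Cphi := smooth_C1 ax sphi.
have [CF DF] := C1M Cu Cphi.
have [cu _ cDu] := Cu; have [cphi _ cDphi] := Cphi.
have near0 x : ~ open_triangle p q r x -> \forall y \near x, phi y = 0.
  move=> nT; have : (~` closure (phi @^-1` [set~ 0])) x by move=> /supp.
  move=> nx; have : \forall y \near x, (~` closure (phi @^-1` [set~ 0])) y.
    by apply: open_nbhs_nbhs; split => //; rewrite openC; exact: closed_closure.
  apply: filterS => y ny; apply: contrapT => phiy; apply: ny.
  exact: subset_closure.
have phi0 x : ~ open_triangle p q r x -> phi x = 0.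
  by move=> /near0 /nbhs_singleton.
have DF0 x : ~ open_triangle p q r x -> 'D_e (fun x => u x * phi x) x = 0.
  move=> /near0 near0x; apply: derive_near0.
  by apply: filterS near0x => y ->; rewrite mulr0.
have E : \int[mu2]_(x in open_triangle p q r) (u x * 'D_e phi x + phi x * 'D_e u x) = 0.
  transitivity (\int[mu2]_x ('D_e (fun x => u x * phi x) x)).
    rewrite Rintegral_mkcond; apply: eq_Rintegral => x _; rewrite patchE -DF.
    by case: ifPn => //; rewrite notin_setE => /DF0 ->.
  rewrite /Rintegral (@integral_derive_plane _ pt e _ (radius p q r))//.
  move=> x nx; rewrite phi0 ?mulr0//.
  by move=> /(open_triangle_square D0).
move: E; rewrite RintegralD//.
- move=> /eqP; rewrite addr_eq0 => /eqP ->.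
  by congr (- _); apply: eq_Rintegral => x _; rewrite mulrC.
- exact: measurable_triangle.
- apply: (continuous_integrable_triangle D0 (f := fun x => u x * 'D_e phi x)) => x.
  by apply: cvgM; [exact: cu|exact: cDphi].
- apply: (continuous_integrable_triangle D0 (f := fun x => phi x * 'D_e u x)) => x.
  by apply: cvgM; [exact: cphi|exact: cDu].
Qed.

Lemma is_axis1 : is_axis (fun s t : R => (s, t)) (e1 R).
Proof. by left. Qed.

Lemma is_axis2 : is_axis (fun s t : R => (t, s)) (e2 R).
Proof. by right. Qed.

Lemma smooth_H1_grad p q r u : det3 p q r != 0 -> smooth u ->
  H1_grad (open_triangle p q r) u ('D_(e1 R) u) ('D_(e2 R) u).
Proof.
move=> D0 su.
have [cu _ cDu1] := smooth_C1 is_axis1 su.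
have [_ _ cDu2] := smooth_C1 is_axis2 su.
split.
- exact: (continuous_L2_triangle D0 cu).
- exact: (continuous_L2_triangle D0 cDu1).
- exact: (continuous_L2_triangle D0 cDu2).
- exact: smooth_weak_derivative is_axis1.
- exact: smooth_weak_derivative is_axis2.
Qed.

Lemma Lnorm_cvg0 d (T : measurableType d) (m : {measure set T -> \bar R}) (f : nat -> T -> R) :
  (forall n (t : T), f n t = 0) -> 'N[m]_2%:E[EFin \o f n]%E @[n --> \oo] --> 0%E.
Proof.
move=> f0; rewrite (_ : (fun n => _) = cst 0%E); first exact: cvg_cst.
apply/funext => n; rewrite (_ : EFin \o f n = cst 0%E) ?Lnorm0 ?eqe ?pnatr_eq0//.
by apply/funext => t /=; rewrite f0.
Qed.

Lemma continuous_L2seg q r u : continuous u -> L2seg q r u.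
Proof.
move=> cu.
have cs : continuous (u \o seg q r).
  by move=> t; apply: (cvg_comp (seg q r) u (@continuous_seg _ q r t)); exact: cu.
have : compact ((u \o seg q r) @` `[0, edist q r]).
  by apply: continuous_compact; [exact: continuous_subspaceT|exact: segment_compact].
move=> /compact_bounded /ex_strict_bound_gt0 [K K0 uK].
apply: (@bounded_Lfun2 _ _ _ mu _ _ K) => //.
- by rewrite /= lebesgue_measure_itv/=; case: ifP => _; rewrite -?EFinD ltry.
- by apply: measurable_funTS; exact: continuous_measurable_fun.
- by move=> t tL; apply/ltW/uK; exists t.
Qed.

(** The constant sequence [u] serves as approximation: every norm that must tend to zero is already
    zero, that on the segment because [g] agrees with [u] there. *)
Lemma smooth_is_trace p q r (s1 s2 : R * R) u g : det3 p q r != 0 -> smooth u ->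
  L2seg s1 s2 g -> (forall t, 0 <= t <= edist s1 s2 -> u (seg s1 s2 t) = g (seg s1 s2 t)) ->
  is_trace (open_triangle p q r) s1 s2 u g.
Proof.
move=> D0 su g2 ug; split => //; exists (fun=> u); split => //.
- exists ('D_(e1 R) u), ('D_(e2 R) u); split.
  + exact: smooth_H1_grad.
  + by apply: Lnorm_cvg0 => n x; rewrite patchE /= subrr; case: ifP.
  + by apply: Lnorm_cvg0 => n x; rewrite patchE /= subrr; case: ifP.
  + by apply: Lnorm_cvg0 => n x; rewrite patchE /= subrr; case: ifP.
- apply: Lnorm_cvg0 => n t; rewrite /on_seg patchE /=; case: ifPn => //.
  by rewrite mem_setE in_itv/= => /ug ->; rewrite subrr.
Qed.

Lemma Rintegral_restrict_mul d (T : measurableType d) (m : {measure set T -> \bar R})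
    (D : set T) (f g : T -> R) :
  \int[m]_(x in D) (f x * g x) = \int[m]_x ((f \_ D) x * (g \_ D) x).
Proof.
rewrite Rintegral_mkcond; apply: eq_Rintegral => x _; rewrite !patchE.
by case: ifP => // _; rewrite mulr0.
Qed.

Lemma L2_integrable_mul D (f g : R * R -> R) : measurable D -> L2 D f -> L2 D g ->
  mu2.-integrable D (EFin \o (fun x => f x * g x)).
Proof.
move=> mD f2 g2; rewrite -(setTI D); apply/integrable_restrict => //.
have := Lfun2_integrable f2 g2; congr (integrable _ _ _).
apply/funext => x /=; rewrite !patchE; case: ifP => //= _; by rewrite mulr0.
Qed.

(* [G] is the weak derivative of [u] along [e]; choosing the axis [e] not parallel
   to the side makes [kappa] nonzero. *)
Lemma green_trace p q r : det3 p q r != 0 ->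
  exists e kappa, kappa != 0 /\
    forall u g, is_trace (open_triangle p q r) q r u g ->
    exists2 G, L2 (open_triangle p q r) G &
      forall k, 1 <= k ->
      \int[mu2]_(x in open_triangle p q r) (u x * 'D_e (weight p q r k) x) +
      \int[mu2]_(x in open_triangle p q r) (G x * weight p q r k x) =
      kappa * \int[mu]_(t in `[0, edist q r]) (g (seg q r t) * side_weight (edist q r) t).
Proof.
move=> D0; have [pt [e [kappa [ax kappa0 green]]]] := green_triangle D0.
have mT := measurable_triangle D0.
set T := open_triangle p q r in mT green *.
exists e, kappa; split => // u g [g2 [phi [sphi [G1 [G2 [HG u_cvg G1_cvg G2_cvg]]] g_cvg]]].
(* As [e] is a coordinate axis, [G] is one of the two components of the weak gradient. *)
have [G GL2 G_cvg] : exists2 G, L2 T G & L2norm T ('D_e (phi n) \- G) @[n --> \oo] --> 0%E.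
  have [_ G1L2 G2L2 _ _] := HG.
  by case: ax => -[-> _]; [exists G1|exists G2].
have [uL2 _ _ _ _] := HG.
exists G => // k k1.
have [cw _ cDw] := C1_weight p q r k ax.
have Cphi n := smooth_C1 ax (sphi n).
have wL2 : L2 T (weight p q r k) by exact: continuous_L2_triangle.
have DwL2 : L2 T ('D_e (weight p q r k)) by exact: continuous_L2_triangle.
have phiL2 n : L2 T (phi n) by have [c _ _] := Cphi n; exact: continuous_L2_triangle.
have DphiL2 n : L2 T ('D_e (phi n)) by have [_ _ c] := Cphi n; exact: continuous_L2_triangle.
have restrictB (D : set (R * R)) (f h : R * R -> R) : (f \- h) \_ D = (f \_ D) \- (h \_ D).
  by apply/funext => x /=; rewrite !patchE; case: ifP => //= _; rewrite subr0.
(* With k fixed, each integral in Green's formula for [phi n] pairs an L_2-convergent sequence with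
   a fixed L_2 function. *)
have lim1 : \int[mu2]_(x in T) (phi n x * 'D_e (weight p q r k) x) @[n --> \oo] -->
            \int[mu2]_(x in T) (u x * 'D_e (weight p q r k) x).
  rewrite Rintegral_restrict_mul.
  under eq_fun do rewrite Rintegral_restrict_mul.
  apply: (@L2_cvg_pairing _ _ _ mu2 (fun n => phi n \_ T) (u \_ T)) => //.
  by move: u_cvg; rewrite /L2norm; under eq_fun do rewrite restrictB.
have lim2 : \int[mu2]_(x in T) ('D_e (phi n) x * weight p q r k x) @[n --> \oo] -->
            \int[mu2]_(x in T) (G x * weight p q r k x).
  rewrite Rintegral_restrict_mul.
  under eq_fun do rewrite Rintegral_restrict_mul.
  apply: (@L2_cvg_pairing _ _ _ mu2 (fun n => ('D_e (phi n) : R * R -> R) \_ T) (G \_ T)) => //.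
  by move: G_cvg; rewrite /L2norm; under eq_fun do rewrite restrictB.
pose L := edist q r; pose I := `[0, L]%classic.
have lim3 : \int[mu]_(t in I) (phi n (seg q r t) * side_weight L t) @[n --> \oo] -->
            \int[mu]_(t in I) (g (seg q r t) * side_weight L t).
  rewrite Rintegral_restrict_mul.
  under eq_fun do rewrite Rintegral_restrict_mul.
  apply: (@L2_cvg_pairing _ _ _ mu (fun n => on_seg q r (phi n)) (on_seg q r g)) => //.
  - by move=> n; have [c _ _] := Cphi n; exact: continuous_L2seg.
  - rewrite (_ : _ \_ _ = on_seg q r (weight p q r k)); first exact: continuous_L2seg.
    by apply/funext => t; rewrite /on_seg !patchE /= weight_seg.
  - have -> : (fun n => 'N[mu]_2%:E[EFin \o (on_seg q r (phi n) \- on_seg q r g)%R]%E) =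
      (fun n => L2seg_norm q r (phi n \- g)); last exact: g_cvg.
    apply/funext => n; rewrite /L2seg_norm; congr Lnorm; congr (_ \o _); apply/funext => t /=.
    by rewrite /on_seg !patchE; case: ifP => //= _; rewrite subr0.
have E n : \int[mu2]_(x in T) (phi n x * 'D_e (weight p q r k) x) +
         \int[mu2]_(x in T) ('D_e (phi n) x * weight p q r k x) =
    kappa * \int[mu]_(t in I) (phi n (seg q r t) * side_weight L t).
  rewrite -(green k (phi n) k1 (Cphi n)) -RintegralD//; first last.
  - exact: L2_integrable_mul.
  - exact: L2_integrable_mul.
  by apply: eq_Rintegral => x _; rewrite [in RHS](mulrC (weight _ _ _ _ _)).
have limR : kappa * \int[mu]_(t in I) (phi n (seg q r t) * side_weight L t) @[n --> \oo] -->
   kappa * \int[mu]_(t in I) (g (seg q r t) * side_weight L t).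
  by apply: cvgM => //; exact: cvg_cst.
apply: (cvg_unique _ _ limR) => //.
rewrite -(funext E); exact: (cvgD lim1 lim2).
Qed.

Lemma weight_le1 p q r k x : det3 p q r != 0 -> open_triangle p q r x ->
  `|weight p q r k x| <= 1.
Proof.
move=> D0; rewrite open_triangleE//= => -[a0 b0 c0].
have s := bary_sum x D0.
have sq (y : R) : y <= 1 -> 0 <= sqpos y <= 1.
  move=> y1; rewrite sqr_ge0/= /sqpos; case: (leP y 0) => y0; first by rewrite expr0n.
  by rewrite expr_le1// ltW.
have /andP[b1 b2] : 0 <= sqpos (bary q r p x) <= 1 by apply: sq; lra.
have /andP[c1 c2] : 0 <= sqpos (bary r p q x) <= 1 by apply: sq; lra.
have /andP[d1 d2] : 0 <= sqpos (1 - (k * bary p q r x) ^+ 2) <= 1.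
  by apply: sq; rewrite gerBl sqr_ge0.
have gen (y z t : R) : 0 <= y -> y <= 1 -> 0 <= z -> z <= 1 -> 0 <= t -> t <= 1 ->
    `|y * z * t| <= 1.
  by move=> *; rewrite ger0_norm ?mulr_ge0// mulr_ile1 ?mulr_ge0// mulr_ile1.
exact: gen.
Qed.

(** At an interior point the weight is eventually exactly zero: once n + 1 exceeds the inverse of
    the coordinate of p, the argument of the cutoff factor is nonpositive. *)
Lemma weight_cvg0 p q r x : det3 p q r != 0 -> open_triangle p q r x ->
  weight p q r n.+1%:R x @[n --> \oo] --> (0 : R).
Proof.
move=> D0; rewrite open_triangleE//= => -[a0 b0 c0].
apply: cvg_near_cst.
exists (Num.truncn (bary p q r x)^-1) => // n /= n_ge.
rewrite /weight [X in _ * X]sqpos_le0 ?mulr0// subr_le0 exprn_ege1//.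
have : (bary p q r x)^-1 < n.+1%:R by rewrite (lt_le_trans (truncnS_gt _))// ler_nat.
by move=> /ltW; rewrite -ler_pdivrMr ?div1r.
Qed.

(** Dominated convergence with bound |G|, which is integrable as the product of [G] and the constant
    1, both in L_2 of the bounded triangle. *)
Lemma integral_weight_cvg0 p q r (G : R * R -> R) : det3 p q r != 0 ->
  L2 (open_triangle p q r) G ->
  \int[mu2]_(x in open_triangle p q r) (G x * weight p q r n.+1%:R x) @[n --> \oo] --> (0 : R).
Proof.
move=> D0 G2; have mT := measurable_triangle D0.
set T := open_triangle p q r in G2 mT *.
have cst1 : L2 T (cst 1) by apply: continuous_L2_triangle => // x; exact: cvg_cst.
have iG : mu2.-integrable T (EFin \o G).
  have := L2_integrable_mul mT G2 cst1.
  by congr (integrable _ _ _); apply/funext => x /=; rewrite mulr1.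
have mG : measurable_fun T G by have /integrableP[/measurable_EFinP] := iG.
have mw n : measurable_fun T (weight p q r n.+1%:R).
  have [c _ _] := C1_weight p q r n.+1%:R is_axis1.
  by apply: measurable_funTS; exact: continuous_measurable_plane.
have m_ n : measurable_fun T (fun x => (G x * weight p q r n.+1%:R x)%:E).
  by apply/measurable_EFinP; exact: measurable_funM.
have cvg_ : {ae mu2, forall x, T x ->
    (fun n => (G x * weight p q r n.+1%:R x)%:E) @ \oo --> cst 0%E x}.
  apply: aeW => x Tx; apply: cvg_EFin; first exact: nearW.
  rewrite /= -[X in _ --> X](mulr0 (G x)); apply: cvgM; first exact: cvg_cst.
  exact: weight_cvg0.
have dom : {ae mu2, forall x n, T x ->
    (`|(G x * weight p q r n.+1%:R x)%:E| <= `|(G x)%:E|)%E}.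
  apply: aeW => x n Tx /=; rewrite lee_fin normrM -[leRHS]mulr1 ler_wpM2l//.
  exact: weight_le1.
have [_ _] := @dominated_convergence _ _ _ mu2 T mT _ _ _ m_ (measurable_cst 0%E)
  cvg_ (integrable_abse iG) dom.
by rewrite integral0; exact: fine_cvg.
Qed.

(** The two traces may come with different functions [G] and [G']. On subtracting the two Green
    formulas the term in [u] cancels, so the constant kappa (I - I') equals a difference of
    integrals that tends to 0. Equality of these weighted integrals is enough to compare multiples
    of one function. *)
Lemma trace_unique p q r u g g' : det3 p q r != 0 ->
  is_trace (open_triangle p q r) q r u g -> is_trace (open_triangle p q r) q r u g' ->
  \int[mu]_(t in `[0, edist q r]) (g (seg q r t) * side_weight (edist q r) t) =
  \int[mu]_(t in `[0, edist q r]) (g' (seg q r t) * side_weight (edist q r) t).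
Proof.
move=> D0; have [e [kappa [kappa0 H]]] := green_trace D0.
move=> /H[G G2 E] /H[G' G'2 E'].
have := integral_weight_cvg0 D0 G2; have := integral_weight_cvg0 D0 G'2.
set I := \int[mu]_(t in _) _; set I' := \int[mu]_(t in _) _.
move=> lim' lim.
apply: (mulfI kappa0); apply/eqP; rewrite -subr_eq0; apply/eqP.
have E0 n : \int[mu2]_(x in open_triangle p q r) (G x * weight p q r n.+1%:R x) -
    \int[mu2]_(x in open_triangle p q r) (G' x * weight p q r n.+1%:R x) = kappa * I - kappa * I'.
  rewrite -(E n.+1%:R) ?ler1n// -(E' n.+1%:R) ?ler1n//.
  by rewrite opprD addrACA subrr add0r.
have c : (fun _ : nat => kappa * I - kappa * I') @ \oo --> (0 : R).
  rewrite -(funext E0) -[X in _ --> X](subr0 (0 : R)).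
  exact: (cvgB lim lim').
by apply: (cvg_unique _ _ c) => //; exact: cvg_cst.
Qed.

End Trace.

(** * Fields supported by one side *)

(* The components are numbered from 1, as in [cpt]. *)
Local Notation ix k := (inord k.-1 : 'I_7).

Section Fields.
Variable R : realType.
Implicit Types (p q r x : R * R) (T : set (R * R)) (v : 'I_7 -> R).
Local Notation mu := (@lebesgue_measure R).
Local Notation edist := (@Defs.edist R).

(** The function h of the overview, for the side [q, r]. *)
Definition bump p q r x : R := bary q r p x * bary r p q x.

Lemma smooth_bump p q r (c : R) : smooth (fun x => c * bump p q r x).
Proof.
by apply: smoothM; [exact: smooth_cst|apply: smoothM; exact: smooth_bary].
Qed.

Lemma continuous_side_weight (L : R) : continuous (side_weight L).
Proof.
move=> t; have [cs _ _] := C1_sqpos R.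
have ct : s / L @[s --> t] --> t / L by apply: cvgM; [exact: cvg_id|exact: cvg_cst].
have c1t : 1 - s / L @[s --> t] --> 1 - t / L by apply: cvgB => //; exact: cvg_cst.
apply: cvgM.
  by apply: (cvg_comp (fun s => 1 - s / L) (@sqpos R) c1t); exact: cs.
by apply: (cvg_comp (fun s => s / L) (@sqpos R) ct); exact: cs.
Qed.

Lemma bump_integrable p q r : mu.-integrable `[0, edist q r]
  (EFin \o (fun t => bump p q r (seg q r t) * side_weight (edist q r) t)).
Proof.
apply: continuous_compact_integrable; first exact: segment_compact.
apply: continuous_subspaceT => t; apply: cvgM; last exact: continuous_side_weight.
by apply: (cvg_comp (seg q r) (bump p q r) (@continuous_seg _ q r t));
  apply: cvgM; exact: continuous_bary.
Qed.

(** With s = t / L the integrand is ((1 - s) s)^3 on the side. It is nonnegative, and on the middle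
    half 1/4 <= s <= 3/4 it is at least (3/16)^3 = 27/4096. *)
Lemma bump_integral_gt0 p q r : det3 p q r != 0 ->
  0 < \int[mu]_(t in `[0, edist q r]) (bump p q r (seg q r t) * side_weight (edist q r) t).
Proof.
move=> D0; have L0 := edist_gt0 D0; set L := edist q r in L0 *.
pose f (t : R) := (1 - t / L) * (t / L) * side_weight L t.
have fE : (fun t => bump p q r (seg q r t) * side_weight L t) = f.
  by apply/funext => t; rewrite /bump; have [_ -> ->] := bary_seg t D0.
have iI : mu.-integrable `[0, L] (EFin \o f) by rewrite -fE; exact: bump_integrable.
rewrite fE.
have itv_sub : `[L / 4, 3 * L / 4] `<=` `[0, L].
  by move=> t /=; rewrite !in_itv/= => /andP[t1 t2]; apply/andP; split; lra.
have f_ge t : L / 4 <= t <= 3 * L / 4 -> 27 / 4096 <= f t.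
  move=> /andP[t1 t2]; have s1 : 1 / 4 <= t / L by rewrite ler_pdivlMr//; lra.
  have s2 : t / L <= 3 / 4 by rewrite ler_pdivrMr//; lra.
  rewrite /f /side_weight /sqpos; set s := t / L in s1 s2 *.
  rewrite !max_l; [|lra..].
  have a1 : 3 / 16 <= (1 - s) * s by nra.
  have -> : (1 - s) * s * ((1 - s) ^+ 2 * s ^+ 2) = ((1 - s) * s) ^+ 3 by ring.
  have -> : 27 / 4096 = (3 / 16) ^+ 3 :> R by field.
  by rewrite lerXn2r// nnegrE; lra.
have f_ge0 t : 0 <= t <= L -> 0 <= f t.
  move=> /andP[t1 t2]; have s0 : 0 <= t / L by rewrite divr_ge0// ltW.
  have s1 : 0 <= 1 - t / L by rewrite subr_ge0 ler_pdivrMr// mul1r.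
  have w0 : 0 <= side_weight L t by exact: (mulr_ge0 (sqr_ge0 _) (sqr_ge0 _)).
  exact: (mulr_ge0 (mulr_ge0 s1 s0) w0).
pose J := `[L / 4, 3 * L / 4]%classic.
apply: (@lt_le_trans _ _ (\int[mu]_(t in J) (27 / 4096))).
  rewrite Rintegral_cst; last exact: measurable_itv.
  have ltJ : L / 4 < 3 * L / 4 by lra.
  rewrite /= lebesgue_measure_itv/= lte_fin ltJ/=.
  by apply: mulr_gt0; lra.
apply: (@le_trans _ _ (\int[mu]_(t in J) f t)).
  apply: le_Rintegral.
  - exact: measurable_itv.
  - apply: continuous_compact_integrable; first exact: segment_compact.
    by apply: continuous_subspaceT => t; exact: cvg_cst.
  - by apply: integrableS iI => //; exact: measurable_itv.
  - by move=> t; rewrite /J /= in_itv/=; exact: f_ge.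
rewrite (_ : J = `[0, L] `&` J); last by apply/esym/setIidr.
rewrite Rintegral_mkcondr; apply: le_Rintegral => //.
- rewrite -restrict_EFin; apply/integrable_restrict => //; first exact: measurable_itv.
  by apply: integrableS iI => //; apply: measurableI => //; exact: measurable_itv.
- move=> t /=; rewrite in_itv/= => tI; rewrite patchE; case: ifP => // _; exact: f_ge0.
Qed.

Definition field (v : 'I_7 -> R) p q r : 'I_7 -> R * R -> R :=
  fun k x => v k * bump p q r x.

(** The operator acts on a field through its coefficient vector: this is the passage from L_2
    functions to linear algebra in R^7. *)
Lemma mxop_field (P : 'M[R]_7) v p q r :
  mxop P (field v p q r) = field (fun k => \sum_(l < 7) P k l * v l) p q r.
Proof.
apply/funext => k; apply/funext => x; rewrite /mxop /field mulr_suml.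
by apply: eq_bigr => l _; rewrite mulrA.
Qed.

Lemma field_H1 p q r T v : det3 p q r != 0 -> T = open_triangle p q r ->
  forall k, H1 T (field v p q r k).
Proof.
move=> D0 -> k; do 2 eexists; apply: smooth_H1_grad => //; exact: smooth_bump.
Qed.

(** Each multiple of the bump is its own trace. Comparing with a common trace [g] through
    [trace_unique] gives y I = z I, where I is the positive integral above. *)
Lemma bump_eq_on_side p q r T (y z : R) : det3 p q r != 0 -> T = open_triangle p q r ->
  eq_on_side T q r (fun x => y * bump p q r x) (fun x => z * bump p q r x) <-> y = z.
Proof.
move=> D0 ->.
have L2b (c : R) : L2seg q r (fun x => c * bump p q r x).
  apply: continuous_L2seg.
  by have [cb _ _] := smooth_C1 (@is_axis1 R) (smooth_bump p q r c).
have tr (c : R) : is_trace (open_triangle p q r) q r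
    (fun x => c * bump p q r x) (fun x => c * bump p q r x).
  by apply: smooth_is_trace => //; exact: smooth_bump.
split=> [[g [ty tz]]|->]; last by exists (fun x => z * bump p q r x).
have := trace_unique D0 (tr y) ty; rewrite -(trace_unique D0 (tr z) tz).
have E (c : R) : \int[mu]_(t in `[0, edist q r])
      (c * bump p q r (seg q r t) * side_weight (edist q r) t) =
    c * \int[mu]_(t in `[0, edist q r])
      (bump p q r (seg q r t) * side_weight (edist q r) t).
  rewrite -RintegralZl//; first by apply: eq_Rintegral => t _; rewrite mulrA.
  exact: bump_integrable.
rewrite !E => /mulIf; apply.
by rewrite gt_eqF// bump_integral_gt0.
Qed.

Lemma bump_vanish p q r T (s1 s2 : R * R) (y : R) : det3 p q r != 0 -> T = open_triangle p q r ->
  (forall t, bump p q r (seg s1 s2 t) = 0) ->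
  zero_on_side T s1 s2 (fun x => y * bump p q r x).
Proof.
move=> D0 -> b0; apply: smooth_is_trace => //; first exact: smooth_bump.
- by apply: continuous_L2seg => x; exact: cvg_cst.
- by move=> t _; rewrite b0 mulr0.
Qed.

(** A zero trace is a trace shared with the zero multiple of the bump. *)
Lemma bump_zero_on_side p q r T (y : R) : det3 p q r != 0 -> T = open_triangle p q r ->
  zero_on_side T q r (fun x => y * bump p q r x) <-> y = 0.
Proof.
move=> D0 hT; have z0 : zero_on_side T q r (fun x => 0 * bump p q r x).
  rewrite hT; apply: smooth_is_trace => //; first exact: smooth_bump.
  - by apply: continuous_L2seg => x; exact: cvg_cst.
  - by move=> t _; rewrite mul0r.
split=> [ty|->//]; apply/(@bump_eq_on_side p q r T y 0 D0 hT).
by exists (cst 0).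
Qed.

Lemma bump_seg_next p q r t : det3 p q r != 0 -> bump p q r (seg r p t) = 0.
Proof.
move=> D0; rewrite /bump; have Dq : det3 q r p != 0 by rewrite det3_rot.
by have [-> _ _] := bary_seg t Dq; rewrite mul0r.
Qed.

Lemma bump_seg_prev p q r t : det3 p q r != 0 -> bump p q r (seg p q t) = 0.
Proof.
move=> D0; rewrite /bump; have Dr : det3 r p q != 0 by rewrite -det3_rot.
by have [-> _ _] := bary_seg t Dr; rewrite mulr0.
Qed.

Lemma field_side p q r T v : det3 p q r != 0 -> T = open_triangle p q r ->
  (forall i j, eq_on_side T q r (cpt (field v p q r) i) (cpt (field v p q r) j)
               <-> v (ix i) = v (ix j)) /\
  (forall i, zero_on_side T q r (cpt (field v p q r) i) <-> v (ix i) = 0).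
Proof.
by move=> D0 hT; split => [i j|i]; [exact: bump_eq_on_side|exact: bump_zero_on_side].
Qed.

(** On each of these sides one factor of the bump is zero, so every component has zero trace and all
    equations there hold for any [v]. *)
Lemma field_other_sides p q r T v : det3 p q r != 0 -> T = open_triangle p q r ->
  [/\ forall i j, eq_on_side T r p (cpt (field v p q r) i) (cpt (field v p q r) j),
      forall i, zero_on_side T r p (cpt (field v p q r) i),
      forall i j, eq_on_side T p q (cpt (field v p q r) i) (cpt (field v p q r) j) &
      forall i, zero_on_side T p q (cpt (field v p q r) i)].
Proof.
move=> D0 hT.
have z1 i : zero_on_side T r p (cpt (field v p q r) i).
  by apply: bump_vanish => // t; exact: bump_seg_next.
have z2 i : zero_on_side T p q (cpt (field v p q r) i).
  by apply: bump_vanish => // t; exact: bump_seg_prev.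
by split => // i j; exists (cst 0); split; exact: z1 || exact: z2.
Qed.

Variables (a b c : R * R).
Hypothesis D0 : det3 a b c != 0.

Let Db : det3 b c a != 0. Proof. by rewrite det3_rot. Qed.
Let Dc : det3 c a b != 0. Proof. by rewrite -det3_rot. Qed.
Let T := open_triangle a b c.
Let Tb : T = open_triangle b c a. Proof. by rewrite open_triangle_rot. Qed.
Let Tc : T = open_triangle c a b. Proof. by rewrite -open_triangle_rot. Qed.

(** The rotations [field v a b c], [field v b c a] and [field v c a b] are carried by Gamma_1,
    Gamma_2 and Gamma_3. This and the next five statements keep only the equations on the carrying
    side. *)
Lemma V1_field1 v : V1 a b c (field v a b c) <-> v (ix 1) = v (ix 2) /\ v (ix 4) = v (ix 7).
Proof.
have [E Z] := field_side v D0 (erefl T).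
have [E1 Z1 E2 Z2] := field_other_sides v D0 (erefl T).
split; first by move=> [_ [[/E ? /E ?] _ _]].
move=> [/E ? /E ?]; split; first by move=> k; exact: field_H1.
by split; split.
Qed.

Lemma V1_field2 v : V1 a b c (field v b c a) <-> v (ix 1) = v (ix 3) /\ v (ix 2) = v (ix 5).
Proof.
have [E Z] := field_side v Db Tb.
have [E1 Z1 E2 Z2] := field_other_sides v Db Tb.
split; first by move=> [_ [_ [/E ? /E ?] _]].
move=> [/E ? /E ?]; split; first by move=> k; exact: field_H1 Db Tb _.
by split; split.
Qed.

Lemma V1_field3 v : V1 a b c (field v c a b) <-> v (ix 1) = v (ix 4) /\ v (ix 3) = v (ix 6).
Proof.
have [E Z] := field_side v Dc Tc.
have [E1 Z1 E2 Z2] := field_other_sides v Dc Tc.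
split; first by move=> [_ [_ _ [/E ? /E ?]]].
move=> [/E ? /E ?]; split; first by move=> k; exact: field_H1 Dc Tc _.
by split; split.
Qed.

Lemma V2_field1 v : V2 a b c (field v a b c) <-> v (ix 1) = v (ix 2) /\ v (ix 3) = v (ix 6).
Proof.
have [E Z] := field_side v D0 (erefl T).
have [E1 Z1 E2 Z2] := field_other_sides v D0 (erefl T).
split; first by move=> [_ [[/E ? /E ?] _ _]].
move=> [/E ? /E ?]; split; first by move=> k; exact: field_H1.
by split; split.
Qed.

Lemma V2_field2 v : V2 a b c (field v b c a) <-> v (ix 1) = v (ix 3) /\ v (ix 4) = v (ix 7).
Proof.
have [E Z] := field_side v Db Tb.
have [E1 Z1 E2 Z2] := field_other_sides v Db Tb.
split; first by move=> [_ [_ [/E ? /E ?] _]].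
move=> [/E ? /E ?]; split; first by move=> k; exact: field_H1 Db Tb _.
by split; split.
Qed.

Lemma V2_field3 v : V2 a b c (field v c a b) <-> v (ix 1) = v (ix 4) /\ v (ix 2) = v (ix 5).
Proof.
have [E Z] := field_side v Dc Tc.
have [E1 Z1 E2 Z2] := field_other_sides v Dc Tc.
split; first by move=> [_ [_ _ [/E ? /E ?]]].
move=> [/E ? /E ?]; split; first by move=> k; exact: field_H1 Dc Tc _.
by split; split.
Qed.

(** For the Dirichlet spaces, the vanishing conditions are extracted from [V1D], the target of P^T,
    and supplied to [V2D], its source. *)
Lemma V1D_field1 v : V1D a b c (field v a b c) ->
  [/\ v (ix 3) = 0, v (ix 5) = 0 & v (ix 6) = 0].
Proof.
have [_ Z] := field_side v D0 (erefl T).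
by move=> [_ [[/Z ? /Z ? /Z ?] _ _]].
Qed.

Lemma V1D_field2 v : V1D a b c (field v b c a) ->
  [/\ v (ix 4) = 0, v (ix 6) = 0 & v (ix 7) = 0].
Proof.
have [_ Z] := field_side v Db Tb.
by move=> [_ [_ [/Z ? /Z ? /Z ?] _]].
Qed.

Lemma V1D_field3 v : V1D a b c (field v c a b) ->
  [/\ v (ix 2) = 0, v (ix 5) = 0 & v (ix 7) = 0].
Proof.
have [_ Z] := field_side v Dc Tc.
by move=> [_ [_ _ [/Z ? /Z ? /Z ?]]].
Qed.

Lemma V2D_field1 v : V2 a b c (field v a b c) ->
  v (ix 4) = 0 -> v (ix 5) = 0 -> v (ix 7) = 0 -> V2D a b c (field v a b c).
Proof.
have [_ Z] := field_side v D0 (erefl T).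
have [_ Z1 _ Z2] := field_other_sides v D0 (erefl T).
by move=> V /Z ? /Z ? /Z ?; split => //; split; split.
Qed.

Lemma V2D_field2 v : V2 a b c (field v b c a) ->
  v (ix 2) = 0 -> v (ix 5) = 0 -> v (ix 6) = 0 -> V2D a b c (field v b c a).
Proof.
have [_ Z] := field_side v Db Tb.
have [_ Z1 _ Z2] := field_other_sides v Db Tb.
by move=> V /Z ? /Z ? /Z ?; split => //; split; split.
Qed.

Lemma V2D_field3 v : V2 a b c (field v c a b) ->
  v (ix 3) = 0 -> v (ix 6) = 0 -> v (ix 7) = 0 -> V2D a b c (field v c a b).
Proof.
have [_ Z] := field_side v Dc Tc.
have [_ Z1 _ Z2] := field_other_sides v Dc Tc.
by move=> V /Z ? /Z ? /Z ?; split => //; split; split.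
Qed.

End Fields.

(** * Unit vectors of R^7 and the vanishing first row *)

Section Final.
Variable R : realType.

(** A zero row i would make the diagonal entry i of P P^-1 equal to 0 instead of 1. *)
Lemma unitmx_row_neq0 n (P : 'M[R]_n) (i : 'I_n) : P \in unitmx -> exists l, P i l != 0.
Proof.
move=> Pu; apply/existsP; apply: contraT; rewrite negb_exists => /forallP P0.
have /matrixP/(_ i i) := mulmxV Pu; rewrite !mxE eqxx big1 => [/esym/eqP|l _].
  by rewrite oner_eq0.
by have /negbNE/eqP -> := P0 l; rewrite mul0r.
Qed.

Definition unit_vec (i : nat) : 'I_7 -> R := fun k => (k == ix i)%:R.

(** The bounds keep [ix] injective: by truncated predecessor and the default value of [inord], 0 and
    every index above 7 are sent to the same ordinal as 1. *)
Lemma unit_vecE i j : (0 < i < 8)%N -> (0 < j < 8)%N -> unit_vec i (ix j) = (j == i)%:R.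
Proof.
case: i => // i; case: j => // j hi hj; rewrite /unit_vec -val_eqE /= !inordK//.
Qed.

Lemma sum_unit_vec (f : 'I_7 -> R) i : \sum_(l < 7) f l * unit_vec i l = f (ix i).
Proof.
rewrite (bigD1 (ix i))//= /unit_vec eqxx mulr1 big1 ?addr0// => l /negbTE ->.
by rewrite mulr0.
Qed.

Lemma sum_unit_vec2 (f : 'I_7 -> R) i j :
  \sum_(l < 7) f l * (unit_vec i l + unit_vec j l) = f (ix i) + f (ix j).
Proof.
by under eq_bigr do rewrite mulrDr; rewrite big_split/= !sum_unit_vec.
Qed.

End Final.

Theorem proposition7p3 (R : realType) (a b c : R * R) (habc : scalene a b c) :
  ~ exists (Phi : ('I_7 -> R * R -> R) -> ('I_7 -> R * R -> R)) (P : 'M[R]_7),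
      [/\ P \in unitmx, Phi = mxop P,
          set_bij (L2_7 a b c) (L2_7 a b c) Phi,
          Phi @` V1 a b c `<=` V2 a b c /\
          mxop P^T @` V2 a b c `<=` V1 a b c &
          Phi @` V1D a b c `<=` V2D a b c /\
          mxop P^T @` V2D a b c `<=` V1D a b c].
Proof.
move=> [Phi [P [Pu -> _ [PV PtV] [_ PtVD]]]].
have D0 : det3 a b c != 0 by have [D0 _ _] := habc.
have toV2 v p q r : V1 a b c (field v p q r) ->
    V2 a b c (field (fun k => \sum_(l < 7) P k l * v l) p q r).
  by move=> Vv; rewrite -mxop_field; apply: PV; exists (field v p q r).
have toV1 v p q r : V2 a b c (field v p q r) ->
    V1 a b c (field (fun k => \sum_(l < 7) P^T k l * v l) p q r).
  by move=> Vv; rewrite -mxop_field; apply: PtV; exists (field v p q r).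
have toV1D v p q r : V2D a b c (field v p q r) ->
    V1D a b c (field (fun k => \sum_(l < 7) P^T k l * v l) p q r).
  by move=> Vv; rewrite -mxop_field; apply: PtVD; exists (field v p q r).
have double0 (y z : R) : y + z = 0 -> y = z -> y = 0.
  by move=> yz0 yz; lra.
(* The indices 3, 5, 6 are those absent from the equations of [V1] on Gamma_1, so the unit vectors
   satisfy them trivially. The lists for the other two sides arise in the same way. *)
have eq12 l : l \in [:: 3; 5; 6]%N -> P (ix 1) (ix l) = P (ix 2) (ix l).
  move=> hl; have : V1 a b c (field (unit_vec R l) a b c).
    by apply/V1_field1 => //; move: hl; rewrite !inE => /or3P[]/eqP->; rewrite !unit_vecE.
  by move=> /toV2 /V2_field1 []//; rewrite !sum_unit_vec.
have eq13 l : l \in [:: 4; 6; 7]%N -> P (ix 1) (ix l) = P (ix 3) (ix l).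
  move=> hl; have : V1 a b c (field (unit_vec R l) b c a).
    by apply/V1_field2 => //; move: hl; rewrite !inE => /or3P[]/eqP->; rewrite !unit_vecE.
  by move=> /toV2 /V2_field2 []//; rewrite !sum_unit_vec.
have eq14 l : l \in [:: 2; 5; 7]%N -> P (ix 1) (ix l) = P (ix 4) (ix l).
  move=> hl; have : V1 a b c (field (unit_vec R l) c a b).
    by apply/V1_field3 => //; move: hl; rewrite !inE => /or3P[]/eqP->; rewrite !unit_vecE.
  by move=> /toV2 /V2_field3 []//; rewrite !sum_unit_vec.
(* Component l of P^T (e_1 + e_2) is P_1l + P_2l. The sum is zero by the Dirichlet condition and its
   two terms are equal by [eq12]. *)
have [P13 P15 P16] : [/\ P (ix 1) (ix 3) = 0, P (ix 1) (ix 5) = 0 & P (ix 1) (ix 6) = 0].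
  have : V2D a b c (field (fun k => unit_vec R 1 k + unit_vec R 2 k) a b c).
    apply: V2D_field1; rewrite // ?unit_vecE ?addr0//.
    by apply/V2_field1 => //; rewrite !unit_vecE// ?addr0 ?add0r.
  move=> /toV1D /V1D_field1 []//; rewrite !sum_unit_vec2 !mxE => s3 s5 s6.
  by split; [apply: double0 s3 _|apply: double0 s5 _|apply: double0 s6 _]; exact: eq12.
have [P14 P17] : P (ix 1) (ix 4) = 0 /\ P (ix 1) (ix 7) = 0.
  have : V2D a b c (field (fun k => unit_vec R 1 k + unit_vec R 3 k) b c a).
    apply: V2D_field2; rewrite // ?unit_vecE ?addr0//.
    by apply/V2_field2 => //; rewrite !unit_vecE// ?addr0 ?add0r.
  move=> /toV1D /V1D_field2 []//; rewrite !sum_unit_vec2 !mxE => s4 _ s7.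
  by split; [apply: double0 s4 _|apply: double0 s7 _]; exact: eq13.
have P12 : P (ix 1) (ix 2) = 0.
  have : V2D a b c (field (fun k => unit_vec R 1 k + unit_vec R 4 k) c a b).
    apply: V2D_field3; rewrite // ?unit_vecE ?addr0//.
    by apply/V2_field3 => //; rewrite !unit_vecE// ?addr0 ?add0r.
  move=> /toV1D /V1D_field3 []//; rewrite !sum_unit_vec2 !mxE => s2 _ _.
  by apply: double0 s2 _; exact: eq14.
have [P23 P25] : P (ix 2) (ix 3) = 0 /\ P (ix 2) (ix 5) = 0 by rewrite -!eq12.
(* P^T e_2 is the second row of [P], to which both equations of [V1] on Gamma_2 apply. *)
have [P21 P22] : P (ix 2) (ix 1) = P (ix 2) (ix 3) /\ P (ix 2) (ix 2) = P (ix 2) (ix 5).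
  have : V2 a b c (field (unit_vec R 2) b c a) by apply/V2_field2 => //; rewrite !unit_vecE.
  by move=> /toV1 /V1_field2 []//; rewrite !sum_unit_vec !mxE.
(* The first two components of P (e_1 + e_2) agree: P_11 + P_12 = P_21 + P_22, where all entries but
   P_11 are already known to be zero. *)
have P11 : P (ix 1) (ix 1) = 0.
  have : V1 a b c (field (fun k => unit_vec R 1 k + unit_vec R 2 k) a b c).
    by apply/V1_field1 => //; rewrite !unit_vecE// ?addr0 ?add0r.
  move=> /toV2 /V2_field1 []//; rewrite !sum_unit_vec2 P12 addr0 => -> _.
  by rewrite P21 P22 P23 P25 addr0.
have [l] := unitmx_row_neq0 (ix 1) Pu; apply/negP; rewrite negbK.
have -> : l = ix l.+1 by rewrite /= inord_val.
case: l => -[|[|[|[|[|[|[|//]]]]]]] _ /=; by apply/eqP.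
Qed.
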